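(* As $n\to\infty$, $$\Bigl|\operatorname*{argmax}_{p\in(0,1)}\frac{\mathrm d}{\mathrm dp}\log\chi_{K_n}(p)-\frac1n\Bigr|=O(n^{-4/3}),\qquad \max_{p\in(0,1)}\frac{\mathrm d}{\mathrm dp}\log\chi_{K_n}(p)=\Theta(n^{4/3}).$$ Explicitly: there are constants $0<c\le C$ and $n_0$ such that for every integer $n\ge n_0$ the function $p\mapsto\frac{\mathrm d}{\mathrm dp}\log\chi_{K_n}(p)$ attains its maximum over $(0,1)$, every maximizer $p^*\in(0,1)$ satisfies $|p^*-1/n|\le Cn^{-4/3}$, and the maximum value lies in $[c\,n^{4/3},C\,n^{4/3}]$.
   Context: For an integer $n\ge1$ and $p\in[0,1]$, $G_{n,p}$ is the Erdős–Rényi random graph on the vertex set $[n]=\{1,\dots,n\}$, in which each of the $\binom n2$ edges of the complete graph $K_n$ is present independently with probability $p$. For a vertex $v$, $C(v)$ is the connected component of $G_{n,p}$ containing $v$ and $|C(v)|$ is its number of vertices. The susceptibility is $\chi_{K_n}(p):=\mathbb E_{n,p}|C(v)|$, which by symmetry does not depend on $v\in[n]$; here $\mathbb E_{n,p}$ is expectation with respect to $G_{n,p}$. It is a polynomial in $p$ with values at least $1$ on $[0,1]$. The notation argmax denotes any maximizer, and $O$, $\Theta$ refer to $n\to\infty$ with absolute implicit constants. *)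

(* Defs.v *)
From HB Require Import structures.
From mathcomp Require Import all_boot all_order all_algebra.
From mathcomp Require Import all_classical all_reals all_analysis.

Set Implicit Arguments.
Unset Strict Implicit.
Unset Printing Implicit Defensive.

Import Order.TTheory GRing.Theory Num.Theory.
Import numFieldNormedType.Exports.

Local Open Scope ring_scope.

Definition Kn_edges (n : nat) : {set {set 'I_n}} := [set e : {set 'I_n} | #|e| == 2%N].

(* A graph on 'I_n is identified with its edge set E, a subset of Kn_edges n. *)
Definition adj (n : nat) (E : {set {set 'I_n}}) : rel 'I_n :=
  fun u w => [set u; w] \in E.

Definition component (n : nat) (E : {set {set 'I_n}}) (v : 'I_n) : {set 'I_n} :=
  [set w | connect (adj E) v w].

(* P(G_{n,p} = E) for E \subset Kn_edges n: product law of the independent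
   Bernoulli(p) edge indicators. *)
Definition Gnp_prob (R : realType) (n : nat) (p : R) (E : {set {set 'I_n}}) : R :=
  \prod_(e in Kn_edges n) (if e \in E then p else 1 - p).

Definition Gnp_expect (R : realType) (n : nat) (p : R)
    (X : {set {set 'I_n}} -> R) : R :=
  \sum_(E in powerset (Kn_edges n)) Gnp_prob p E * X E.

(* The base vertex v is kept as a parameter; the value does not depend on it. *)
Definition susceptibility (R : realType) (n : nat) (v : 'I_n) (p : R) : R :=
  Gnp_expect p (fun E => #|component E v|%:R).

Definition dlog_susceptibility (R : realType) (n : nat) (v : 'I_n) (p : R) : R :=
  derive1 (fun q : R => ln (susceptibility v q)) p.

Definition is_argmax (R : realType) (A : set R) (f : R -> R) (x : R) : Prop :=
  A x /\ forall y : R, A y -> f y <= f x.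

(* Main.v *)
Require Import Defs.
From HB Require Import structures.
From mathcomp Require Import all_boot all_order all_algebra.
From mathcomp Require Import all_classical all_reals all_analysis.
From mathcomp Require Import ring lra zify.
From mathcomp Require Import fintype finset.

Set Implicit Arguments.
Unset Strict Implicit.
Unset Printing Implicit Defensive.

Import Order.TTheory GRing.Theory Num.Theory.
Import numFieldNormedType.Exports.

Local Open Scope ring_scope.

(** Let [K] be the size of the component of a vertex of G(n,p), [chi n] its
    mean and q = 1 - p.  The proof rests on one formula,
      P_n(K = k) = C(n-1, k-1) * conn k * q^(k (n-k)),
    in which [conn k], the probability that G(k,p) is connected, does not
    involve n.  At fixed p the laws of [K] for different numbers of vertices are
    therefore explicit multiples of each other: passing from n to n + 1 multiplies
    the mass at k by n / (n + 1 - k) * q^k ([law_step]).  Multiplying d such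
    factors gives [law_tilt],
      P_n(K = k) <= exp (k d / n * (0.52 (d + k) / n + 1 - n p)) * P_(n-d)(K = k).
    If n p > 1 and k stays somewhat below 2 (n p - 1) n, the exponent is negative
    for a suitable d, so a supercritical graph is compared with a smaller one; if
    n - d is subcritical, the branching bound [chi n <= 1 / (1 - n p)] applies
    there ([chi_subcritical]).

    The derivative is governed by Russo's formula, where an absent edge counts if
    it leaves the component of the root; conditioning on that component leaves
    an independent graph on n - K vertices, and
      (1 - p) * chi_n' = E_n [K (n - K) chi_(n-K)]       ([russo]).
    The logarithmic derivative is thus about n times the mean of chi_(n-K) under
    the law of [K] biased by size.  It is estimated in each regime of p.
    - If n p <= 1 - b, it is at most 2 n [chi n] <= 2 n / b.
    - If n p <= 1 + b, then [chi n] <= (24 / b) exp (13 b^3 n)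
      ([chi_window_le]): a second moment bound, obtained from the mere fact that
      the law for n + 1 vertices has mass at most 1, controls large components,
      and [law_tilt] controls the others.
    - If n p = 1 + e with 16 n^(-1/3) <= e <= 1/150, it is O(n / e)
      ([logder_supercritical]).  A component larger than (9/8) e n leaves a
      subcritical graph; components smaller than (7/8) e n are compared with a
      subcritical graph; those in between are less likely by a factor
      exp (- c e^3 n) than in a smaller graph, which beats the bound on chi_(n-K)
      just quoted, taken at b = e / 8.
    - Further above criticality it is O(n) ([logder_macroscopic],
      [logder_dense]).
    - At n p = 1 - 16 n^(-1/3) it is at least n^(4/3) / 256
      ([logder_subcritical_ge]): comparison with a larger, still subcritical,
      graph bounds the second moment of [K], whence [chi n] is at least half
      of the branching bound and Russo's formula loses only constants.
    Hence outside a window of width L n^(-4/3) around 1/n the function stays below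
    its value at one point inside, and inside it is O(n^(4/3)). *)

(** * The law of the component size *)

(** Among m + 1 vertices the component of a root is either everything or has
    j <= m vertices; the latter has probability
    C(m, j-1) * conn j * (1 - X)^(j (m+1-j)).  Since the total mass is 1, this
    determines [conn (m + 1)] from the previous values. *)
Definition conn_step (R : comNzRingType) (s : seq {poly R}) (m : nat) : {poly R} :=
  1 - \sum_(j < m.+1) 'C(m, j.-1)%:R * s`_j * (1 - 'X) ^+ (j * (m.+1 - j)).

(** Course-of-values recursion: the list of [conn 0], ..., [conn n]. *)
Fixpoint conn_seq (R : comNzRingType) (n : nat) : seq {poly R} :=
  if n is m.+1 then rcons (conn_seq R m) (conn_step (conn_seq R m) m) else [:: 0].

(** The probability, as a polynomial in p, that G(n,p) is connected.  The
    value 0 at n = 0 makes every term of size 0 disappear from the sums below,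
    in spite of the truncated predecessors. *)
Definition conn (R : comNzRingType) (n : nat) : {poly R} := (conn_seq R n)`_n.

Definition comp_law (R : comNzRingType) (n k : nat) : {poly R} :=
  'C(n.-1, k.-1)%:R * conn R k * (1 - 'X) ^+ (k * (n - k)).

Definition chi_poly (R : comNzRingType) (n : nat) : {poly R} :=
  \sum_(k < n.+1) k%:R * comp_law R n k.

Lemma size_conn_seq (R : comNzRingType) (n : nat) : size (conn_seq R n) = n.+1.
Proof. by elim: n => //= n IHn; rewrite size_rcons IHn. Qed.

Lemma nth_conn_seq (R : comNzRingType) (n k : nat) :
  (k <= n)%N -> (conn_seq R n)`_k = conn R k.
Proof.
elim: n => [|n IHn]; first by rewrite leqn0 => /eqP->.
rewrite leq_eqVlt => /predU1P[->//|lt_kn].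
by rewrite /= nth_rcons size_conn_seq lt_kn IHn.
Qed.

Lemma conn0 (R : comNzRingType) : conn R 0 = 0.
Proof. by []. Qed.

Lemma connS (R : comNzRingType) (m : nat) :
  conn R m.+1 = 1 - \sum_(j < m.+1) 'C(m, j.-1)%:R * conn R j
                                      * (1 - 'X) ^+ (j * (m.+1 - j)).
Proof.
rewrite /conn /= nth_rcons size_conn_seq ltnn eqxx /conn_step.
congr (1 - _); apply: eq_bigr => j _.
by rewrite nth_conn_seq // -ltnS ltn_ord.
Qed.

Lemma sum_comp_law (R : comNzRingType) (n : nat) : (0 < n)%N ->
  \sum_(k < n.+1) comp_law R n k = 1.
Proof.
case: n => // n _; rewrite big_ord_recr /= /comp_law /= binn subnn muln0 expr0.
by rewrite mulr1 mul1r connS addrC subrK.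
Qed.

(** Multiplying C(n-1, k-1) by n / (n+1-k) gives C(n, k-1), and one more
    vertex adds k edges that must be absent. *)
Lemma comp_law_step (R : comNzRingType) (n k : nat) : (0 < k <= n)%N ->
  (n.+1 - k)%:R * comp_law R n.+1 k
  = n%:R * (1 - 'X) ^+ k * comp_law R n k.
Proof.
case/andP; case: k => // k _ lt_kn; case: n lt_kn => // n; rewrite ltnS => le_kn.
rewrite /comp_law /= !subSS.
have -> : (k.+1 * (n.+1 - k) = k.+1 + k.+1 * (n - k))%N by rewrite subSn // mulnS.
have E : ((n.+1 - k) * 'C(n.+1, k) = n.+1 * 'C(n, k))%N.
  by rewrite mul_bin_down.
rewrite exprD !mulrA -natrM E natrM; ring.
Qed.

Lemma sum_triangle (V : nmodType) (F : nat -> nat -> V) (n : nat) :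
  \sum_(i < n) \sum_(a < i) F a i
  = \sum_(a < n) \sum_(e < n - a.+1) F a (a + e.+1)%N.
Proof.
elim: n => [|n IHn]; first by rewrite !big_ord0.
rewrite big_ord_recr IHn [RHS]big_ord_recr /= subnn big_ord0 addr0 -big_split /=.
apply: eq_bigr => a _; have lt_an := ltn_ord a.
have -> : (n.+1 - a.+1 = (n - a.+1).+1)%N by lia.
rewrite big_ord_recr /=; congr (_ + F _ _); lia.
Qed.

(** Both sides choose disjoint sets of a and e + 1 elements and a distinguished
    element of the second. *)
Lemma bin_three_blocks (a e t : nat) :
  ('C(a + e.+1 + t, a + e.+1) * 'C(a + e.+1, a) * e.+1
   = 'C(a + e.+1 + t, a) * (e.+1 + t) * 'C(e + t, e))%N.
Proof.
have F0 : (0 < a`! * e`! * t`!)%N by rewrite !muln_gt0 !fact_gt0.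
apply/eqP; rewrite -(eqn_pmul2r F0); apply/eqP.
have h1 := @bin_fact (a + e.+1 + t) (a + e.+1) (leq_addr _ _).
have h2 := @bin_fact (a + e.+1) a (leq_addr _ _).
have h3 := @bin_fact (a + e.+1 + t) a ltac:(lia).
have h4 := @bin_fact (e + t) e (leq_addr _ _).
rewrite addKn in h1; rewrite addKn in h2; rewrite addKn in h4.
have E3 : (a + e.+1 + t - a = (e + t).+1)%N by lia.
rewrite E3 factS in h3; rewrite factS in h2.
have ac1 (x y z u v w : nat) : (x * y * z * (u * v * w) = x * (y * (u * (z * v)) * w))%N.
  by ring.
have ac2 (x y z u v w : nat) : (x * y * z * (u * v * w) = x * (u * (y * (z * (v * w)))))%N.
  by ring.
rewrite ac1 h2 h1 addSn ac2 h4.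
by rewrite -h3.
Qed.

(** * Derivatives of the law *)

(** The derivation (1 - p) d/dp: by Russo's formula it counts absent edges that
    are pivotal, and it multiplies a power of 1 - p by an integer. *)
Definition qderiv (R : comNzRingType) (f : {poly R}) : {poly R} := (1 - 'X) * f^`().

Lemma qderivM (R : comNzRingType) (f g : {poly R}) :
  qderiv (f * g) = qderiv f * g + f * qderiv g.
Proof. rewrite /qderiv derivM; ring. Qed.

Lemma qderiv_sum (R : comNzRingType) (n : nat) (F : nat -> {poly R}) :
  qderiv (\sum_(i < n) F i) = \sum_(i < n) qderiv (F i).
Proof. by rewrite /qderiv raddf_sum mulr_sumr. Qed.

Lemma qderiv_natM (R : comNzRingType) (n : nat) (f : {poly R}) :
  qderiv (n%:R * f) = n%:R * qderiv f.
Proof. by rewrite !mulr_natl /qderiv derivMn mulrnAr. Qed.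

Lemma qderiv_exp (R : comNzRingType) (m : nat) :
  qderiv ((1 - 'X) ^+ m) = - m%:R * (1 - 'X) ^+ m :> {poly R}.
Proof.
rewrite /qderiv deriv_exp derivB derivX -[1]/(1%:P) derivC sub0r.
case: m => [|m]; first by rewrite !mulr0n mulr0 oppr0 mul0r.
rewrite /= -mulr_natl exprS; ring.
Qed.

Lemma qderiv1 (R : comNzRingType) : qderiv (1 : {poly R}) = 0.
Proof. by rewrite /qderiv -[1]/(1%:P) derivC mulr0. Qed.

(** The expected number of absent edges whose addition connects a graph on
    k + 1 vertices: the graph then has two components, of a + 1 and k - a
    vertices, the first containing the root. *)
Definition conn_merge (R : comNzRingType) (k : nat) : {poly R} :=
  \sum_(a < k) 'C(k, a)%:R * (a.+1 * (k - a))%:R * conn R a.+1 * conn R (k - a)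
               * (1 - 'X) ^+ (a.+1 * (k - a)).

(** A component of i + 1 vertices obtained by merging two pieces can be listed
    by choosing first the piece of the root and then the other piece, which is a
    component of the graph on the remaining n - a vertices. *)
Lemma sum_conn_merge (R : comNzRingType) (n : nat) (phi : nat -> {poly R}) :
  \sum_(i < n.+1) 'C(n, i)%:R * (1 - 'X) ^+ (i.+1 * (n - i)) * conn_merge R i * phi i
  = \sum_(a < n) (a.+1 * (n - a))%:R * comp_law R n.+1 a.+1
      * \sum_(e < n - a) comp_law R (n - a) e.+1 * phi (a + e.+1)%N.
Proof.
rewrite /conn_merge.
under eq_bigr => i _ do rewrite mulr_sumr mulr_suml.
rewrite (@sum_triangle _ (fun a i => 'C(n, i)%:R * (1 - 'X) ^+ (i.+1 * (n - i)) *
  ('C(i, a)%:R * (a.+1 * (i - a))%:R * conn R a.+1 * conn R (i - a) *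
    (1 - 'X) ^+ (a.+1 * (i - a))) * phi i)).
rewrite big_ord_recr /= subnn big_ord0 addr0.
apply: eq_bigr => a _; rewrite subSS mulr_sumr; apply: eq_bigr => e _.
have lt_an := ltn_ord a; have lt_e := ltn_ord e.
move: (nat_of_ord a) (nat_of_ord e) lt_an lt_e => {a}a {e}e lt_an lt_e.
have [t En] : exists t, n = (a + e.+1 + t)%N by exists (n - (a + e.+1))%N; lia.
rewrite /comp_law /= !subSS.
have -> : (a + e.+1 - a = e.+1)%N by lia.
have -> : ((n - a).-1 = e + t)%N by lia.
have E : ('C(n, a + e.+1) * 'C(a + e.+1, a) * (a.+1 * e.+1)
   = (a.+1 * (n - a)) * 'C(n, a) * 'C(e + t, e))%N.
  have ac (x y z u : nat) : (x * y * (z * u) = z * (x * y * u))%N by ring.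
  have -> : (n - a = e.+1 + t)%N by lia.
  by rewrite ac En bin_three_blocks; ring.
have {}E := congr1 (fun m : nat => m%:R : {poly R}) E.
rewrite /= !natrM in E.
have Q : ((a + e.+1).+1 * (n - (a + e.+1)) + a.+1 * e.+1
  = a.+1 * (n - a) + e.+1 * (n - a - e.+1))%N.
  have -> : (n - (a + e.+1) = t)%N by lia.
  have -> : (n - a = e.+1 + t)%N by lia.
  rewrite addKn; ring.
have {}Q : (1 - 'X) ^+ ((a + e.+1).+1 * (n - (a + e.+1))) * (1 - 'X) ^+ (a.+1 * e.+1)
  = (1 - 'X) ^+ (a.+1 * (n - a)) * (1 - 'X) ^+ (e.+1 * (n - a - e.+1)) :> {poly R}.
  by rewrite -!exprD; congr (_ ^+ _).
rewrite !natrM.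
transitivity (('C(n, a + e.+1)%:R * 'C(a + e.+1, a)%:R * (a.+1%:R * e.+1%:R)) *
  ((1 - 'X) ^+ ((a + e.+1).+1 * (n - (a + e.+1))) * (1 - 'X) ^+ (a.+1 * e.+1))
  * (conn R a.+1 * conn R e.+1 * phi (a + e.+1)%N)); first by ring.
rewrite E Q; ring.
Qed.

Lemma sum_comp_lawS (R : comNzRingType) (n : nat) : (0 < n)%N ->
  \sum_(e < n) comp_law R n e.+1 = 1.
Proof.
move=> n0; rewrite -(sum_comp_law R n0) big_ord_recl.
by rewrite {2}/comp_law conn0 mulr0 mul0r add0r.
Qed.

Lemma chi_polyS (R : comNzRingType) (n : nat) :
  chi_poly R n = \sum_(e < n) e.+1%:R * comp_law R n e.+1.
Proof. by rewrite /chi_poly big_ord_recl mul0r add0r. Qed.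

(** Differentiating the identity that the law has mass 1 expresses the
    derivative of [conn] through smaller instances; [sum_conn_merge] with
    weight 1 shows that [conn_merge] satisfies the same recursion. *)
Lemma qderiv_conn (R : comNzRingType) (k : nat) :
  qderiv (conn R k.+1) = conn_merge R k.
Proof.
elim/ltn_ind: k => n IHn.
have /(congr1 (@qderiv R)) := sum_comp_lawS R (ltn0Sn n).
rewrite (qderiv_sum _ (fun e => comp_law R n.+1 e.+1)) qderiv1.
have step (e : 'I_n.+1) : qderiv (comp_law R n.+1 e.+1)
  = 'C(n, e)%:R * (1 - 'X) ^+ (e.+1 * (n - e)) * qderiv (conn R e.+1)
    - (e.+1 * (n - e))%:R * comp_law R n.+1 e.+1.
  rewrite /comp_law /= subSS qderivM qderiv_natM qderiv_exp; ring.
rewrite (eq_bigr _ (fun e _ => step e)) sumrB => /eqP; rewrite subr_eq0 => /eqP E.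
have := @sum_conn_merge R n (fun=> 1).
under eq_bigr do rewrite mulr1.
under [in RHS]eq_bigr => a _.
  have an : (0 < n - a)%N by rewrite subn_gt0.
  under eq_bigr do rewrite mulr1.
  rewrite (sum_comp_lawS _ an) mulr1; over.
move=> E2.
have E3 : \sum_(e < n.+1) 'C(n, e)%:R * (1 - 'X) ^+ (e.+1 * (n - e)) * conn_merge R e =
   \sum_(e < n.+1) 'C(n, e)%:R * (1 - 'X) ^+ (e.+1 * (n - e)) * qderiv (conn R e.+1).
  by rewrite E E2 [RHS]big_ord_recr /= subnn muln0 mul0r addr0.
move: E3; rewrite !big_ord_recr /= binn subnn muln0 expr0 !mul1r.
rewrite (eq_bigr (fun e : 'I_n => 'C(n, e)%:R * (1 - 'X) ^+ (e.+1 * (n - e)) * qderiv (conn R e.+1))).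
  by move/addrI.
by move=> e _; rewrite IHn.
Qed.

(** Conditionally on the component of the root having k vertices, each of its
    k (n - k) absent outgoing edges leads to a uniform vertex of an independent
    graph on n - k vertices. *)
Lemma qderiv_chi (R : comNzRingType) (n : nat) :
  qderiv (chi_poly R n)
  = \sum_(k < n.+1) (k * (n - k))%:R * comp_law R n k * chi_poly R (n - k).
Proof.
case: n => [|n].
  by rewrite /chi_poly !big_ord1 !mul0r /qderiv deriv0 mulr0.
rewrite chi_polyS (qderiv_sum _ (fun e => e.+1%:R * comp_law R n.+1 e.+1)).
have step (e : 'I_n.+1) : qderiv (e.+1%:R * comp_law R n.+1 e.+1)
  = 'C(n, e)%:R * (1 - 'X) ^+ (e.+1 * (n - e)) * conn_merge R e * e.+1%:R
    - (e.+1 * (n - e))%:R * comp_law R n.+1 e.+1 * e.+1%:R.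
  rewrite -qderiv_conn /comp_law /= subSS qderiv_natM qderivM qderiv_natM qderiv_exp.
  ring.
rewrite (eq_bigr _ (fun e _ => step e)) sumrB (@sum_conn_merge R n (fun e => e.+1%:R)).
rewrite [X in _ - X]big_ord_recr /= subnn muln0 !mul0r addr0 -sumrB.
rewrite [RHS]big_ord_recl /= mul0n !mul0r add0r big_ord_recr /= subnn muln0 !mul0r addr0.
apply: eq_bigr => a _; rewrite /bump /= add1n subSS -mulrBr; congr (_ * _).
have an : (0 < n - a)%N by rewrite subn_gt0.
have E : \sum_(e < n - a) comp_law R (n - a) e.+1 * a.+1%:R = a.+1%:R.
  by rewrite -mulr_suml sum_comp_lawS // mul1r.
rewrite chi_polyS -[X in _ - X]E -sumrB; apply: eq_bigr => e _.
have -> : (a + e.+1).+1%:R = a.+1%:R + e.+1%:R :> {poly R} by rewrite -natrD addSn.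
ring.
Qed.

(** * Integrating out absent edges *)

Lemma sum_powersetU1 (T : finType) (V : nmodType) (S : {set T}) (e : T)
    (F : {set T} -> V) : e \in S ->
  \sum_(E in powerset S) F E = \sum_(E in powerset (S :\ e)) (F E + F (e |: E)).
Proof.
move=> eS; rewrite (bigID (fun E : {set T} => e \in E)) /= addrC big_split /=.
congr (_ + _).
  by apply: eq_bigl => E; rewrite !powersetE subsetD1.
rewrite (reindex_onto (fun E : {set T} => e |: E) (fun E => E :\ e)) /=; last first.
  by move=> E /andP[_ eE]; rewrite setD1K.
apply: eq_bigl => E; rewrite !powersetE subsetD1 subUset sub1set eS setU11 /= andbT.
case: (boolP (E \subset S)) => //= _; apply/eqP/idP => [<-|eE].
  by rewrite !inE eqxx.
by rewrite setU1K.
Qed.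

Lemma Gnp_expect_edge (R : realType) (n : nat) (p : R) (e : {set 'I_n})
    (X : {set {set 'I_n}} -> R) : e \in Kn_edges n ->
  Gnp_expect p X =
  \sum_(E in powerset (Kn_edges n :\ e))
    (\prod_(f in Kn_edges n :\ e) (if f \in E then p else 1 - p))
    * ((1 - p) * X E + p * X (e |: E)).
Proof.
move=> eK; rewrite /Gnp_expect (sum_powersetU1 _ eK); apply: eq_bigr => E.
rewrite powersetE subsetD1 => /andP[_ eE].
rewrite /Gnp_prob !(big_setD1 e eK) /= setU11 (negPf eE).
rewrite [X in _ + _ * X * _](eq_bigr (fun f => if f \in E then p else 1 - p)).
  by rewrite mulrDr !mulrA; congr (_ * _ + _ * _); rewrite mulrC.
by move=> f; rewrite !inE => /andP[/negPf-> _].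
Qed.

Lemma eq_Gnp_expect (R : realType) (n : nat) (p : R) (X Y : {set {set 'I_n}} -> R) :
  (forall E : {set {set 'I_n}}, E \subset Kn_edges n -> X E = Y E) -> Gnp_expect p X = Gnp_expect p Y.
Proof.
by move=> XY; apply: eq_bigr => E; rewrite powersetE => /XY ->.
Qed.

Lemma Gnp_expect_absent1 (R : realType) (n : nat) (p : R) (e : {set 'I_n})
    (X : {set {set 'I_n}} -> R) : e \in Kn_edges n -> (forall E, X (E :\ e) = X E) ->
  Gnp_expect p (fun E => X E * (e \notin E)%:R) = (1 - p) * Gnp_expect p X.
Proof.
move=> eK XD; rewrite !(Gnp_expect_edge _ _ eK) mulr_sumr; apply: eq_bigr => E.
rewrite powersetE subsetD1 => /andP[_ eE].
rewrite eE setU11 /= mulr0 mulr0 mulr1 addr0.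
have -> : X (e |: E) = X E by rewrite -XD setU1K.
ring.
Qed.

(** Edges on which a random variable does not depend are independent of it. *)
Lemma Gnp_expect_absent (R : realType) (n : nat) (p : R) (D : {set {set 'I_n}})
    (X : {set {set 'I_n}} -> R) : D \subset Kn_edges n ->
  (forall E, X (E :\: D) = X E) ->
  Gnp_expect p (fun E => X E * [disjoint D & E]%:R) = (1 - p) ^+ #|D| * Gnp_expect p X.
Proof.
have [k] := ubnP #|D|; elim: k => // k IHk in D *.
have [->|[e eD]] := set_0Vmem D.
  move=> _ _ _; rewrite cards0 expr0 mul1r; apply: eq_Gnp_expect => E _.
  by rewrite disjoints_subset sub0set mulr1.
move=> Dk DK XD; have eK := subsetP DK _ eD.
have XD' (E : {set {set 'I_n}}) : X (E :\: (D :\ e)) = X E.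
  rewrite -XD -[in RHS]XD; congr X.
  by apply/setP => f; rewrite !inE; case: (f \in D) => //=; rewrite andbF.
have XDe (E : {set {set 'I_n}}) : X (E :\ e) = X E.
  rewrite -XD -[in RHS]XD; congr X.
  by apply/setP => f; rewrite !inE; case: eqVneq => //= ->; rewrite eD.
have card_D : #|D| = #|D :\ e|.+1 by rewrite (cardsD1 e D) eD.
have disjD (E : {set {set 'I_n}}) :
    [disjoint D & E] = [disjoint D :\ e & E] && (e \notin E).
  by rewrite -!setI_eq0 -[in LHS](setD1K eD) setIUl setU_eq0 andbC ![_ :&: E == _]setI_eq0 disjoints1.
rewrite card_D exprS -mulrA -IHk //; last first.
- exact: fintype.subset_trans (subD1set _ _) DK.
- by move: Dk; rewrite card_D.
rewrite -(Gnp_expect_absent1 _ eK).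
  by apply: eq_Gnp_expect => E _; rewrite disjD -mulrA -natrM mulnb.
move=> E; rewrite XDe; congr (_ * _%:R); congr nat_of_bool.
rewrite -!setI_eq0; congr (_ == _).
by apply/setP=> f; rewrite !inE; case: (f == e).
Qed.

(** * The component of a vertex in a random graph *)

Definition edges_inside (n : nat) (A : {set 'I_n}) (E : {set {set 'I_n}}) :
  {set {set 'I_n}} := [set e in E | e \subset A].

(** The pairs joining B to the rest of A. *)
Definition cut_edges (n : nat) (A B : {set 'I_n}) : {set {set 'I_n}} :=
  [set [set u.1; u.2] | u in setX B (A :\: B)].

Lemma connect_invariant (T : finType) (e : rel T) (B : {set T}) (x y : T) :
  (forall u w, u \in B -> e u w -> w \in B) -> x \in B -> connect e x y -> y \in B.
Proof.
move=> Be xB /connectP[s es ->]; elim: s x xB es => //= w s IHs x xB /andP[exw ews].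
by apply: IHs ews; exact: Be exw.
Qed.

Lemma component_inside_self (n : nat) (A : {set 'I_n}) (E : {set {set 'I_n}}) (v : 'I_n) :
  v \in A -> component (edges_inside A E) v \subset A.
Proof.
move=> vA; apply/subsetP => w; rewrite inE; apply: connect_invariant vA.
move=> x y _; rewrite /adj inE => /andP[_ /subsetP]; apply; exact: set22.
Qed.

Lemma cut_edge (n : nat) (A B : {set 'I_n}) (x y : 'I_n) :
  x \in B -> y \in A -> y \notin B -> [set x; y] \in cut_edges A B.
Proof.
by move=> xB yA yB; apply/imsetP; exists (x, y); rewrite // in_setX inE xB yB.
Qed.

(** This separates the event that the component inside A is B into two events
    that depend on disjoint sets of edges. *)
Lemma component_inside_eq (n : nat) (A B : {set 'I_n}) (E : {set {set 'I_n}}) (v : 'I_n) :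
  B \subset A -> v \in B ->
  (component (edges_inside A E) v == B)
  = (component (edges_inside B E) v == B) && [disjoint cut_edges A B & E].
Proof.
move=> /subsetP BA vB.
have sub : subrel (adj (edges_inside B E)) (adj (edges_inside A E)).
  move=> x y; rewrite /adj !inE => /andP[-> /subsetP sB] /=.
  by apply/subsetP => z /sB/BA.
have {}sub : subrel (connect (adj (edges_inside B E))) (connect (adj (edges_inside A E))).
  by apply: connect_sub => x y /sub; exact: connect1.
apply/eqP/andP => [CB|[/eqP CB dis]]; last first.
  apply/setP => w; apply/idP/idP; last by rewrite -[in w \in B]CB !inE => /sub.
  rewrite inE; apply: connect_invariant vB => x y xB.
  rewrite /adj inE => /andP[xyE /subsetP xyA]; apply/negPn/negP => yB.
  have := cut_edge xB (xyA _ (set22 _ _)) yB.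
  by move/(disjointFr dis); rewrite xyE.
split.
  apply/eqP/setP => w; apply/idP/idP; first by rewrite -[in w \in B]CB !inE => /sub.
  rewrite -[in w \in B]CB !inE => /connectP[s es ->].
  elim/last_ind: s es => [|s y IHs]; first by rewrite connect0.
  rewrite rcons_path last_rcons => /andP[es]; rewrite /adj inE => /andP[lyE /subsetP lyA].
  have Cx : connect (adj (edges_inside A E)) v (last v s) by apply/connectP; exists s.
  have xB : last v s \in B by rewrite -CB inE.
  apply: connect_trans (IHs es) _; apply: connect1; rewrite /adj inE lyE /=.
  apply/subsetP => z /set2P[->//|->]; rewrite -CB inE.
  apply: connect_trans Cx _; apply: connect1.
  by rewrite /adj inE lyE /=; apply/subsetP.
rewrite disjoint_subset; apply/subsetP => e /imsetP[[x y] /=].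
rewrite in_setX inE => /andP[/= xB /andP[/negP yB yA]] ->; apply/negP => xyE; apply: yB.
have Cx : connect (adj (edges_inside A E)) v x by have := xB; rewrite -CB inE.
rewrite -CB inE; apply: connect_trans Cx _; apply: connect1; rewrite /adj inE xyE /=.
by apply/subsetP => z /set2P[->|->]//; exact: BA.
Qed.

Lemma card_cut_edges (n : nat) (A B : {set 'I_n}) :
  #|cut_edges A B| = (#|B| * #|A :\: B|)%N.
Proof.
rewrite -cardsX card_in_imset // => -[x y] [x' y'].
rewrite !in_setX !inE /= => /andP[xB /andP[yB _]] /andP[xB' /andP[yB' _]] E.
have : x \in [set x'; y'] by rewrite -E set21.
case/set2P => [xx|xy]; last by rewrite -xy xB in yB'.
have : y \in [set x'; y'] by rewrite -E set22.
case/set2P => [yx|->]; last by rewrite xx.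
by rewrite yx xB' in yB.
Qed.

Lemma cut_edges_sub (n : nat) (A B : {set 'I_n}) : cut_edges A B \subset Kn_edges n.
Proof.
apply/subsetP => e /imsetP[[x y] /=]; rewrite in_setX inE => /andP[/= xB /andP[yB _]] ->.
rewrite inE cards2; have [xy|//] := eqVneq x y.
by rewrite -xy xB in yB.
Qed.

Lemma expect_component_cut (R : realType) (n : nat) (p : R) (A B : {set 'I_n}) (v : 'I_n) :
  B \subset A -> v \in B ->
  Gnp_expect p (fun E => (component (edges_inside A E) v == B)%:R) =
  (1 - p) ^+ (#|B| * #|A :\: B|)
  * Gnp_expect p (fun E => (component (edges_inside B E) v == B)%:R).
Proof.
move=> BA vB; rewrite -card_cut_edges -Gnp_expect_absent ?cut_edges_sub //.
  by apply: eq_Gnp_expect => E _; rewrite component_inside_eq // -natrM mulnb.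
move=> E; congr (_ == _)%:R; congr component.
apply/setP => e; rewrite !inE; case: (boolP (e \subset B)); rewrite ?andbF ?andbT // => eB.
suff -> : e \notin cut_edges A B by [].
apply/imsetP => -[[x y] /=]; rewrite in_setX inE => /andP[_ /andP[/= yB _]] E1.
by move: yB; rewrite (subsetP eB) // E1 set22.
Qed.

Lemma Gnp_expect1 (R : realType) (n : nat) (p : R) :
  Gnp_expect p (fun _ : {set {set 'I_n}} => 1) = 1.
Proof.
have key (S : {set {set 'I_n}}) :
    \sum_(E in powerset S) \prod_(e in S) (if e \in E then p else 1 - p) = 1.
  have [k] := ubnP #|S|; elim: k => // k IHk in S *.
  have [->|[e eS]] := set_0Vmem S.
    by move=> _; rewrite powerset0 big_set1 big_set0.
  rewrite (cardsD1 e S) eS ltnS => /IHk; rewrite (sum_powersetU1 _ eS) => IH; rewrite -[RHS]IH.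
  apply: eq_bigr => E; rewrite powersetE subsetD1 => /andP[_ eE].
  rewrite !(big_setD1 e eS) /= setU11 (negPf eE).
  rewrite [X in _ + _ * X](eq_bigr (fun f => if f \in E then p else 1 - p)).
    by rewrite -mulrDl subrK mul1r.
  by move=> f; rewrite !inE => /andP[/negPf-> _].
by rewrite -[RHS](key (Kn_edges n)); apply: eq_bigr => E _; rewrite mulr1.
Qed.

Lemma Gnp_expect_sum (R : realType) (n : nat) (p : R) (I : finType) (P : pred I)
    (X : I -> {set {set 'I_n}} -> R) :
  Gnp_expect p (fun E => \sum_(i | P i) X i E) = \sum_(i | P i) Gnp_expect p (X i).
Proof. by rewrite exchange_big; apply: eq_bigr => E _; rewrite mulr_sumr. Qed.

Lemma Gnp_expectZ (R : realType) (n : nat) (p a : R) (X : {set {set 'I_n}} -> R) :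
  Gnp_expect p (fun E => a * X E) = a * Gnp_expect p X.
Proof. by rewrite mulr_sumr; apply: eq_bigr => E _; rewrite mulrCA. Qed.

Lemma expect_component (R : realType) (n : nat) (p : R) (A : {set 'I_n}) (v : 'I_n)
    (phi : {set 'I_n} -> R) : v \in A ->
  Gnp_expect p (fun E => phi (component (edges_inside A E) v)) =
  \sum_(B : {set 'I_n} | (v \in B) && (B \subset A)) phi B *
     Gnp_expect p (fun E => (component (edges_inside A E) v == B)%:R).
Proof.
move=> vA; under [RHS]eq_bigr do rewrite -Gnp_expectZ.
rewrite -Gnp_expect_sum; apply: eq_Gnp_expect => E _.
rewrite (bigD1 (component (edges_inside A E) v)) /=; last first.
  by rewrite component_inside_self // inE connect0.
rewrite eqxx mulr1 big1 ?addr0 // => B /andP[_].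
by rewrite eq_sym => /negPf ->; rewrite mulr0.
Qed.

Lemma sum_subsets_by_card (V : nmodType) (n : nat) (A : {set 'I_n}) (v : 'I_n)
    (F : nat -> V) : v \in A -> F 0%N = 0 ->
  \sum_(B : {set 'I_n} | (v \in B) && (B \subset A)) F #|B|
  = \sum_(k < #|A|.+1) F k *+ 'C(#|A|.-1, k.-1).
Proof.
move=> vA F0.
rewrite (partition_big (fun B : {set 'I_n} => inord #|B| : 'I_#|A|.+1) xpredT) //=.
apply: eq_bigr => k _; case: k => -[|k] /= lk.
  rewrite F0 mul0rn big1 // => B /andP[/andP[vB BA]].
  move/eqP/(congr1 val); rewrite /= inordK; last by rewrite ltnS subset_leq_card.
  by move/eqP; rewrite cards_eq0 => /eqP B0; rewrite B0 inE in vB.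
rewrite (eq_bigr (fun=> F k.+1)); last first.
  move=> B /andP[/andP[vB BA]] /eqP/(congr1 val); rewrite /= inordK => [->//|].
  by rewrite ltnS subset_leq_card.
rewrite sumr_const; congr (_ *+ _).
have -> : #|A|.-1 = #|A :\ v| by rewrite [in LHS](cardsD1 v) vA.
rewrite -cards_draws.
rewrite -[RHS](@card_in_imset _ _ (fun B : {set 'I_n} => v |: B)).
  apply: eq_card => B; rewrite [LHS]inE; apply/idP/imsetP => [|[B' ]].
    case/andP => /andP[vB BA] /eqP/(congr1 val); rewrite /= inordK; last by rewrite ltnS subset_leq_card.
    move=> cB; exists (B :\ v); last by rewrite setD1K.
    rewrite inE setSD //=; move: cB; rewrite (cardsD1 v) vB add1n => -[->].
    by rewrite eqxx.
  rewrite inE subsetD1 => /andP[/andP[BA vB] /eqP cB] ->.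
  rewrite setU11 subUset sub1set vA BA /=; apply/eqP/val_inj; rewrite /= inordK.
    by rewrite cardsU1 vB cB.
  by rewrite ltnS subset_leq_card // subUset sub1set vA BA.
move=> B B'; rewrite !inE !subsetD1 => /andP[/andP[_ vB] _] /andP[/andP[_ vB'] _] E.
by rewrite -(setU1K vB) E setU1K.
Qed.

(** Summing [expect_component_cut] over the possible components of [v] inside B
    gives the recursion that defines [conn]. *)
Lemma expect_connected (R : realType) (n : nat) (p : R) (B : {set 'I_n}) (v : 'I_n) :
  v \in B ->
  Gnp_expect p (fun E => (component (edges_inside B E) v == B)%:R) = (conn R #|B|).[p].
Proof.
have [k] := ubnP #|B|; elim: k => // k IHk in B *; rewrite ltnS => Bk vB.
have := @expect_component R n p B v (fun=> 1) vB; rewrite Gnp_expect1.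
have B0 : (0 < #|B|)%N by rewrite (cardsD1 v B) vB.
pose F i : R := (conn R i).[p] * (1 - p) ^+ (i * (#|B| - i)).
have FB : F #|B| = (conn R #|B|).[p] by rewrite /F subnn muln0 expr0 mulr1.
have sumF : \sum_(B' : {set 'I_n} | (v \in B') && (B' \subset B)) F #|B'| = 1.
  rewrite sum_subsets_by_card //; last by rewrite /F conn0 horner0 mul0r.
  have := sum_comp_law R B0 => /(congr1 (horner^~ p)).
  rewrite horner_sum hornerC => <-; apply: eq_bigr => i _.
  rewrite /comp_law /F mulr_natl mulrnAl hornerMn !hornerE.
  by [].
rewrite (bigD1 B) /= ?vB ?subxx // mul1r => E1.
move: sumF; rewrite [RHS]E1 (bigD1 B) /= ?vB ?subxx // FB.
rewrite (eq_bigr (fun B' : {set 'I_n} => 1 * Gnp_expect p (fun E : {set {set 'I_n}} =>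
    (component (edges_inside B E) v == B')%:R))); first by move/addIr.
move=> B' /andP[/andP[vB' BB'] nBB'].
rewrite mul1r expect_component_cut // IHk //=; last first.
  by apply: leq_trans Bk; apply: proper_card; rewrite properEneq nBB'.
rewrite mulrC /F; congr (_ * _ ^+ (_ * _)).
by rewrite cardsD (setIidPr BB').
Qed.

Lemma conn_ge0 (R : realType) (p : R) (k : nat) : 0 <= p <= 1 -> 0 <= (conn R k).[p].
Proof.
move=> /andP[p0 p1]; case: k => [|k]; first by rewrite conn0 horner0.
have := @expect_connected R k.+1 p [set: 'I_k.+1] ord0 (in_setT _).
rewrite cardsT card_ord => <-; apply: sumr_ge0 => E _; apply: mulr_ge0 => //.
by apply: prodr_ge0 => e _; case: ifP; rewrite ?subr_ge0.
Qed.

Lemma susceptibilityE (R : realType) (n : nat) (v : 'I_n) (p : R) :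
  susceptibility v p = (chi_poly R n).[p].
Proof.
rewrite /susceptibility.
rewrite (@eq_Gnp_expect _ _ _ _
   (fun E => #|component (edges_inside [set: 'I_n] E) v|%:R)); last first.
  move=> E _; congr (#|component _ v|%:R).
  by apply/setP => e; rewrite inE subsetT andbT.
rewrite (@expect_component R n p _ v (fun B => #|B|%:R)) ?in_setT //.
rewrite (eq_bigr (fun B : {set 'I_n} => (fun k => k%:R * ((conn R k).[p] * (1 - p) ^+ (k * (n - k)))) #|B|)).
  rewrite (@sum_subsets_by_card _ _ _ _ (fun k => k%:R * ((conn R k).[p] * (1 - p) ^+ (k * (n - k))))) //.
    rewrite cardsT card_ord /chi_poly horner_sum; apply: eq_bigr => i _.
    rewrite /comp_law !mulr_natl !mulrnAl !hornerMn !hornerE.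
    by rewrite mulrnAC.
  by rewrite in_setT.
  by rewrite mul0r.
move=> B /andP[vB _]; rewrite expect_component_cut ?subsetT // expect_connected //.
congr (_ * _); rewrite mulrC; congr (_ * _ ^+ (_ * _)).
by rewrite cardsD setTI cardsT card_ord.
Qed.

Local Open Scope classical_set_scope.
Local Open Scope ring_scope.

(** * The law at a real parameter *)

Definition law (R : realType) (p : R) (n k : nat) : R := (comp_law R n k).[p].
Definition chi (R : realType) (p : R) (n : nat) : R := (chi_poly R n).[p].

Lemma law_ge0 (R : realType) (p : R) (n k : nat) : 0 <= p <= 1 -> 0 <= law p n k.
Proof.
move=> p01; rewrite /law /comp_law mulr_natl mulrnAl hornerMn !hornerE.
apply: mulrn_wge0; apply: mulr_ge0; first exact: conn_ge0.
by apply: exprn_ge0; rewrite subr_ge0; case/andP: p01.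
Qed.

Lemma law0 (R : realType) (p : R) (n : nat) : law p n 0 = 0.
Proof. by rewrite /law /comp_law conn0 mulr0 mul0r horner0. Qed.

Lemma law_small (R : realType) (p : R) (n k : nat) : (0 < n < k)%N -> law p n k = 0.
Proof.
move=> nk; rewrite /law /comp_law bin_small ?mul0r ?horner0 //; lia.
Qed.

Lemma sum_law (R : realType) (p : R) (n : nat) : (0 < n)%N -> \sum_(k < n.+1) law p n k = 1.
Proof.
move=> n0; have /(congr1 (horner^~ p)) := sum_comp_law R n0.
by rewrite horner_sum hornerC.
Qed.

Lemma chiE (R : realType) (p : R) (n : nat) : chi p n = \sum_(k < n.+1) k%:R * law p n k.
Proof.
rewrite /chi /chi_poly horner_sum; apply: eq_bigr => k _.
by rewrite !mulr_natl hornerMn.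
Qed.

(** The relation behind the whole proof: at fixed p the laws for n and n + 1
    vertices are explicit multiples of each other on every k. *)
Lemma law_step (R : realType) (p : R) (n k : nat) : (k <= n)%N ->
  (n.+1 - k)%:R * law p n.+1 k = n%:R * (1 - p) ^+ k * law p n k.
Proof.
case: k => [|k] kn; first by rewrite !law0 !mulr0.
have /(congr1 (horner^~ p)) := @comp_law_step R n k.+1 kn.
rewrite /law; move: (comp_law R n.+1 _) (comp_law R n _) => f g.
by rewrite -!mulrA !mulr_natl !hornerMn !hornerE.
Qed.

Lemma sum_law_widen (R : realType) (p : R) (m n : nat) (g : nat -> R) : (0 < m <= n)%N ->
  \sum_(k < n.+1) g k * law p m k = \sum_(k < m.+1) g k * law p m k.
Proof.
move=> /andP[m0 mn]; rewrite [RHS](big_ord_widen n.+1 (fun k => g k * law p m k)) //.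
rewrite [RHS]big_mkcond /=; apply: eq_bigr => k _; case: ifP => // /negbT.
by rewrite -leqNgt => mk; rewrite law_small ?mulr0 // m0.
Qed.

Lemma chi_ge0 (R : realType) (p : R) (n : nat) : 0 <= p <= 1 -> 0 <= chi p n.
Proof.
by move=> p01; rewrite chiE; apply: sumr_ge0 => k _; rewrite mulr_ge0 ?law_ge0.
Qed.

Lemma chi_ge1 (R : realType) (p : R) (n : nat) : 0 <= p <= 1 -> (0 < n)%N -> 1 <= chi p n.
Proof.
move=> p01 n0; rewrite chiE -[leLHS](sum_law p n0); apply: ler_sum => -[[|k] lk] _ /=.
  by rewrite law0 mulr0.
by rewrite ler_peMl ?law_ge0 // ler1n.
Qed.

Lemma chi_le (R : realType) (p : R) (n : nat) : 0 <= p <= 1 -> chi p n <= n%:R.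
Proof.
move=> p01; case: n => [|n]; first by rewrite chiE big_ord1 mul0r.
have -> : n.+1%:R = n.+1%:R * \sum_(k < n.+2) law p n.+1 k by rewrite sum_law ?mulr1.
rewrite chiE mulr_sumr; apply: ler_sum => k _.
by rewrite ler_wpM2r ?law_ge0 // ler_nat -ltnS ltn_ord.
Qed.

(** A new vertex is connected to a given old vertex unless it has no edge to its
    component.  Here the identity is obtained by summing [law_step] over k. *)
Lemma chi_succ (R : realType) (p : R) (n : nat) :
  chi p n.+1 = 1 + n%:R * (1 - \sum_(k < n.+1) (1 - p) ^+ k * law p n k).
Proof.
have E : \sum_(k < n.+2) (n.+1 - k)%:R * law p n.+1 k =
   n%:R * \sum_(k < n.+1) (1 - p) ^+ k * law p n k.
  rewrite big_ord_recr /= subnn mul0r addr0 mulr_sumr; apply: eq_bigr => k _.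
  by rewrite law_step ?mulrA // -ltnS ltn_ord.
have : \sum_(k < n.+2) (n.+1 - k)%:R * law p n.+1 k = n.+1%:R - chi p n.+1.
  have -> : n.+1%:R = n.+1%:R * \sum_(k < n.+2) law p n.+1 k by rewrite sum_law ?mulr1.
  rewrite chiE mulr_sumr -sumrB.
  by apply: eq_bigr => k _; rewrite natrB ?mulrBl // -ltnS ltn_ord.
rewrite E => E2; rewrite mulrBr mulr1 E2 -natr1; ring.
Qed.

Lemma bernoulli_ineq (R : realType) (p : R) (k : nat) :
  0 <= p <= 1 -> 1 - k%:R * p <= (1 - p) ^+ k.
Proof.
move=> p01; elim: k => [|k IHk]; first by rewrite mul0r subr0 expr0.
have kp : 0 <= k%:R * p * p by rewrite !mulr_ge0 //; case/andP: p01.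
rewrite exprS -natr1; apply: le_trans (ler_wpM2l _ IHk); last by lra.
by lra.
Qed.

(** By [chi_succ] and Bernoulli's inequality [chi (n + 1) <= 1 + n p chi n],
    and 1 / (1 - n p) is a supersolution of this recursion. *)
Lemma chi_subcritical (R : realType) (p : R) (n : nat) : 0 <= p <= 1 -> n%:R * p < 1 ->
  chi p n <= (1 - n%:R * p)^-1.
Proof.
move=> p01; have p0 : 0 <= p by case/andP: p01.
elim: n => [|n IHn] np1; first by rewrite chiE big_ord1 mul0r invr_ge0 mul0r subr0 ler01.
have np2 : n%:R * p < 1 by apply: le_lt_trans np1; rewrite ler_wpM2r // ler_nat.
have d0 : 0 < 1 - n%:R * p by lra.
have d1 : 0 < 1 - n.+1%:R * p by lra.
apply: (@le_trans _ _ (1 + n%:R * p * chi p n)).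
  rewrite chi_succ lerD2l -mulrA; case: n {IHn np1 np2 d0 d1} => [|n]; first by rewrite !mul0r.
  rewrite ler_wpM2l // chiE -{1}(sum_law p (ltn0Sn n)) -sumrB mulr_sumr.
  apply: ler_sum => k _; rewrite -[X in X - _]mul1r -mulrBl mulrA ler_wpM2r ?law_ge0 //.
  by rewrite mulrC; have := bernoulli_ineq k p01; lra.
apply: (@le_trans _ _ (1 - n%:R * p)^-1).
  have := IHn np2; have np0 : 0 <= n%:R * p by rewrite mulr_ge0.
  move=> /(ler_wpM2l np0) H; apply: (le_trans (lerD (lexx 1) H)).
  by rewrite -subr_ge0; have -> : (1 - n%:R * p)^-1 - (1 + n%:R * p * (1 - n%:R * p)^-1) = 0; 
    [field; lra|].
rewrite lef_pV2 ?posrE //; have : n%:R * p <= n.+1%:R * p by rewrite ler_wpM2r // ler_nat.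
lra.
Qed.

(** The ratio of the laws for n + 1 and n vertices, as a function of k, crosses
    the value 1 only once, upwards. *)
Lemma law_crossing (R : realType) (p : R) (n k : nat) : 0 <= p <= 1 -> (0 < k <= n)%N ->
  (n.+1 - k)%:R <= n%:R * (1 - p) ^+ k -> (n - k)%:R <= n%:R * (1 - p) ^+ k.+1.
Proof.
move=> /andP[p0 p1] /andP[k0 kn] H.
have E : (n - k)%:R = (n.+1 - k)%:R - 1 :> R by rewrite subSn // -natr1 addrK.
have q0 : 0 <= 1 - p by lra.
have qk0 : 0 <= (1 - p) ^+ k by rewrite exprn_ge0.
have B : (1 - p) ^+ k * (1 + k%:R * p) <= 1.
  have : (1 - p) ^+ k * (1 + p) ^+ k <= 1.
    by rewrite -exprMn; apply: exprn_ile1; nra.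
  apply: le_trans; apply: ler_wpM2l => //.
  elim: k {k0 kn H E qk0} => [|j IHj]; first by rewrite mul0r addr0 expr0.
  have jp : 0 <= j%:R * p by rewrite mulr_ge0.
  rewrite exprS -natr1; apply: le_trans (ler_wpM2l _ IHj); last by lra.
  by nra.
set a := (n.+1 - k)%:R in H E *.
have k1 : 1 <= k%:R :> R by rewrite ler1n.
have a0 : 0 <= a by rewrite ler0n.
have nE : n%:R = a + k%:R - 1 :> R.
  by rewrite /a natrB; [rewrite -natr1; lra|exact: leq_trans kn _].
have n0 : 0 <= n%:R :> R by [].
have H2 : a * (1 + k%:R * p) <= n%:R.
  have kp : 0 <= 1 + k%:R * p by rewrite addr_ge0 // mulr_ge0 // (le_trans ler01).
  apply: (le_trans (ler_wpM2r kp H)); rewrite -mulrA -[leRHS]mulr1.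
  by apply: ler_wpM2l.
have ap : a * p <= 1 by nra.
rewrite E exprS mulrCA; apply: (@le_trans _ _ ((1 - p) * a)); first by nra.
exact: ler_wpM2l.
Qed.

(** Single crossing implies stochastic domination: with m the first size at
    which the larger graph has more mass, every term of the sum of
    (k - m) (P_(n+1)(k) - P_n(k)) is nonnegative. *)
Lemma chi_mono1 (R : realType) (p : R) (n : nat) : 0 <= p <= 1 -> chi p n <= chi p n.+1.
Proof.
move=> p01; case: n => [|n]; first by rewrite {1}chiE big_ord1 mul0r chi_ge0.
set N := n.+1.
pose P k := (0 < k)%N && ((N.+1 - k)%:R <= N%:R * (1 - p) ^+ k).
have q0 : 0 <= 1 - p by rewrite subr_ge0; case/andP: p01.
have exP : exists k, P k.
  by exists N.+1; rewrite /P /= subnn mulr_ge0 // exprn_ge0.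
case: (ex_minnP exP) => m /andP[m0 Pm] minm.
have up k : (m <= k <= N)%N -> (N.+1 - k)%:R <= N%:R * (1 - p) ^+ k.
  elim: k => [|k IHk]; first by rewrite leqNgt m0.
  rewrite leq_eqVlt => /andP[/predU1P[<-//|mk] kN].
  rewrite subSS; apply: law_crossing => //.
    by rewrite (leq_trans m0) //= ltnW.
  by apply: IHk; rewrite -ltnS mk ltnW.
have down k : (0 < k < m)%N -> N%:R * (1 - p) ^+ k <= (N.+1 - k)%:R.
  move=> /andP[k0 km]; rewrite leNgt; apply/negP => /ltW H.
  by have := minm k; rewrite /P k0 H leqNgt km => /(_ isT).
rewrite -subr_ge0.
have -> : chi p N.+1 - chi p N =
   \sum_(k < N.+2) (k%:R - m%:R) * (law p N.+1 k - law p N k).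
  under [RHS]eq_bigr => k _ do rewrite mulrBl !mulrBr.
  rewrite !sumrB (@sum_law_widen _ p N N.+1 (fun=> m%:R)) ?leqnSn //=.
  rewrite (@sum_law_widen _ p N N.+1 (fun k => k%:R)) ?leqnSn //=.
  rewrite -!mulr_sumr !sum_law // -!chiE; ring.
apply: sumr_ge0 => -[k /= lk] _.
have [->|k0] := posnP k; first by rewrite !law0 subrr mulr0.
have [kN|kN] := leqP k N; last first.
  have -> : law p N k = 0 by rewrite law_small //.
  rewrite subr0 mulr_ge0 ?law_ge0 // subr_ge0 ler_nat.
  apply: minm; rewrite /P k0 /=.
  have -> : (N.+1 - k = 0)%N by apply/eqP; rewrite subn_eq0.
  by rewrite mulr_ge0 // exprn_ge0.
have a0 : 0 < (N.+1 - k)%:R :> R by rewrite ltr0n subn_gt0.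
have St := law_step p kN; have L0 := law_ge0 N k p01.
have [mk|km] := leqP m k.
  apply: mulr_ge0; first by rewrite subr_ge0 ler_nat.
  rewrite subr_ge0 -(ler_pM2l a0) St ler_wpM2r //.
  by apply: up; rewrite mk.
apply: mulr_le0; first by rewrite subr_le0 ler_nat ltnW.
rewrite subr_le0 -(ler_pM2l a0) St ler_wpM2r //.
by apply: down; rewrite k0.
Qed.

Lemma chi_mono (R : realType) (p : R) (m n : nat) : 0 <= p <= 1 -> (m <= n)%N ->
  chi p m <= chi p n.
Proof.
move=> p01; elim: n => [|n IHn]; first by rewrite leqn0 => /eqP->.
rewrite leq_eqVlt => /predU1P[->//|]; rewrite ltnS => /IHn /le_trans; apply.
exact: chi_mono1.
Qed.

(** * Exponential inequalities *)

Lemma is_derive_poly_expR (R : realType) (P Q : {poly R}) (t : R) :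
  is_derive t 1 (fun s => P.[s] * expR Q.[s]) ((P^`() + P * Q^`()).[t] * expR Q.[t]).
Proof.
have dE : is_derive t 1 (expR \o horner Q) (Q^`().[t] * expR Q.[t]).
  by apply: is_derive_eq; rewrite mulrC.
have -> : (fun s => P.[s] * expR Q.[s]) = horner P * (expR \o horner Q) by [].
apply: is_derive_eq; rewrite /= !hornerE /GRing.scale /=; ring.
Qed.

Lemma poly_expR_le (R : realType) (P Q : {poly R}) (t : R) : 0 <= t ->
  (forall s, 0 < s < t -> 0 <= (P^`() + P * Q^`()).[s]) ->
  P.[0] * expR Q.[0] <= P.[t] * expR Q.[t].
Proof.
rewrite le_eqVlt => /predU1P[<-//|t0] H.
have dF s := is_derive_poly_expR P Q s.
have [|c /= c01 E] := @MVT R (fun s => P.[s] * expR Q.[s]) _ 0 t t0 (fun s _ => dF s).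
  apply: continuous_subspaceT => s; apply: differentiable_continuous.
  by apply/derivable1_diffP; case: (dF s).
rewrite -subr_ge0 E; apply: mulr_ge0; last by rewrite subr0 ltW.
by apply: mulr_ge0; [apply: H; move: c01; rewrite in_itv|exact: expR_ge0].
Qed.

(** A second order upper bound for 1 / (1 - t), with th as close to the optimal
    1/2 as the range of t permits. *)
Lemma one_sub_expR_ge1 (R : realType) (th t : R) :
  0 <= th -> 0 <= t -> 2 * th * t <= 2 * th - 1 -> 1 <= (1 - t) * expR (t + th * t ^+ 2).
Proof.
move=> th0 t0 ht; have := @poly_expR_le R (1 - 'X) ('X + th *: 'X^2) t t0.
rewrite !hornerE ?expr0n /= ?mulr0 ?addr0 expR0 !subr0 mulr1 => H; apply: H => s /andP[s0 st].
rewrite !poly.derivE !hornerE.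
rewrite [leRHS](_ : _ = s * (2 * th - 1 - 2 * th * s)); last by ring.
apply: mulr_ge0; first exact: ltW.
by have := ler_wpM2l th0 (ltW st); lra.
Qed.

Lemma one_sub_expR_le1 (R : realType) (t : R) :
  0 <= t -> (1 - t) * expR (t + t ^+ 2 / 2) <= 1.
Proof.
move=> t0; have := @poly_expR_le R ('X - 1) ('X + 2^-1 *: 'X^2) t t0.
rewrite !hornerE ?expr0n /= ?mulr0 ?addr0 expR0 !mulr1 => H.
rewrite -lerN2 -mulNr opprB [t ^+ 2 / 2]mulrC; suff h : forall s : R, 0 < s < t -> 0 <= (('X - 1)^`() + ('X - 1) * ('X + 2^-1 *: 'X^2)^`()).[s].
  by move/H: h; rewrite -mulrA -expr2.
move=> s /andP[s0 st]; rewrite !poly.derivE !hornerE.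
rewrite [leRHS](_ : _ = s ^+ 2); last by field.
exact: sqr_ge0.
Qed.

Lemma expR_one_sub (R : realType) (p : R) : 0 <= p <= 2^-1 -> expR (- (p + p ^+ 2)) <= 1 - p.
Proof.
move=> /andP[p0 p2]; rewrite expRN -[leLHS]mul1r ler_pdivrMr ?expR_gt0 //.
by have := @one_sub_expR_ge1 R 1 p ler01 p0; rewrite mul1r; apply; lra.
Qed.

Lemma one_sub_expR (R : realType) (p : R) : 1 - p <= expR (- p).
Proof. exact: expR_ge1Dx. Qed.

Lemma one_sub_pow_expR (R : realType) (p : R) (k : nat) : 0 <= p <= 1 ->
  (1 - p) ^+ k <= expR (- (k%:R * p)).
Proof.
move=> p01; rewrite -mulrN expRM_natl; apply: lerXn2r; rewrite ?nnegrE ?expR_ge0 //.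
  by rewrite subr_ge0; case/andP: p01.
exact: one_sub_expR.
Qed.

(** * Comparing different numbers of vertices *)

Lemma law_ratio (R : realType) (p : R) (m k : nat) : (k <= m)%N ->
  law p m.+1 k = m%:R / (m.+1 - k)%:R * (1 - p) ^+ k * law p m k.
Proof.
move=> km; have a0 : (m.+1 - k)%:R != 0 :> R by rewrite pnatr_eq0 -lt0n subn_gt0.
by apply: (mulfI a0); rewrite law_step //; field.
Qed.

Lemma law_descent_le (R : realType) (p r : R) (n d k : nat) : 0 <= r -> (d <= n)%N ->
  (forall m, (n - d <= m < n)%N -> law p m.+1 k <= r * law p m k) ->
  law p n k <= r ^+ d * law p (n - d) k.
Proof.
move=> r0; elim: d => [|d IHd] dn H; first by rewrite subn0 expr0 mul1r.
apply: (le_trans (IHd (ltnW dn) _)).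
  by move=> m /andP[m1 m2]; apply: H; rewrite m2 andbT (leq_trans _ m1) // leq_sub2l.
rewrite exprSr -mulrA; apply: ler_wpM2l; first exact: exprn_ge0.
have -> : (n - d = (n - d.+1).+1)%N by lia.
by apply: H; lia.
Qed.

(** With t = (K - 1) / (N - I - 1) the factor is 1 / (1 - t), and t is at most
    K / (N - I).  Here N is the number of vertices at the start and I
    the number already removed. *)
Lemma step_factor_le (R : realType) (N K I : R) : 0 < N -> 1 <= K -> 0 <= I ->
  K * 128 <= N -> (I + 1) * 128 <= N ->
  (N - I - 1) / (N - I - K)
  <= expR (K / N + 52 / 100 * (K / N) ^+ 2 + 104 / 100 * (K / N) * (I / N)).
Proof.
move=> N0 K1 I0 KN IN.
have a0 : 0 < N - I - 1 by lra.
have b0 : 0 < N - I by lra.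
have c0 : 0 < N - I - K by lra.
have t0 : 0 <= (K - 1) / (N - I - 1) by apply: divr_ge0; lra.
have tu : (K - 1) / (N - I - 1) <= K / (N - I).
  rewrite ler_pdivrMr // mulrAC ler_pdivlMr //; nra.
have uE : K / (N - I) * (1 - I / N) = K / N by field; apply/andP; split; lra.
have E : (N - I - 1) / (N - I - K) = (1 - (K - 1) / (N - I - 1))^-1.
  by field; rewrite -?andbA; repeat (apply/andP; split); lra.
rewrite E; clear E.
have k0' : 0 <= K / N by apply: divr_ge0; lra.
have k1' : K / N <= 128^-1 by rewrite ler_pdivrMr //; lra.
have i0' : 0 <= I / N by apply: divr_ge0; lra.
have i1' : I / N <= 128^-1 by rewrite ler_pdivrMr //; lra.
move: (K / N) (I / N) (K / (N - I)) ((K - 1) / (N - I - 1)) k0' k1' i0' i1' t0 tu uE.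
clear => x y u t x0 x1 y0 y1 t0 tu uE.
have u0 : 0 <= u by lra.
have u1 : u <= x * (1 + 104 / 100 * y).
  rewrite -uE -subr_ge0 [leRHS](_ : _ = u * y * (4 / 100 - 104 / 100 * y)); last by field.
  by rewrite !mulr_ge0 //; lra.
have u2 : u <= 1008 / 1000 * x by have := ler_wpM2l u0 y1; lra.
have t1 : t <= 99 / 10000 by lra.
apply: (@le_trans _ _ (expR (t + 505 / 1000 * t ^+ 2))).
  rewrite -[leLHS]mul1r ler_pdivrMr; last by lra.
  by rewrite mulrC; apply: one_sub_expR_ge1; lra.
rewrite ler_expR; nra.
Qed.

Lemma law_step_sharp (R : realType) (p : R) (n i k : nat) : 0 <= p <= 1 -> (0 < k)%N ->
  (k * 128 <= n)%N -> (i.+1 * 128 <= n)%N ->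
  law p (n - i) k <=
  expR (k%:R * ((1 + 52 / 100 * k%:R / n%:R + 104 / 100 * i%:R / n%:R) / n%:R - p))
  * law p (n - i.+1) k.
Proof.
move=> p01 k0 kn dn.
have [M EM] : exists M, (n - i = M.+2)%N by exists (n - i - 2)%N; lia.
have -> : (n - i.+1 = M.+1)%N by lia.
rewrite EM law_ratio; last by lia.
apply: ler_wpM2r; first exact: law_ge0.
have q0 : 0 <= 1 - p by rewrite subr_ge0; case/andP: p01.
have N0 : 0 < n%:R :> R by rewrite ltr0n; lia.
have K1 : 1 <= k%:R :> R by rewrite ler1n.
have KN : k%:R * 128 <= n%:R :> R by rewrite -natrM ler_nat.
have IN : (i%:R + 1) * 128 <= n%:R :> R by rewrite natr1 -natrM ler_nat.
have M1 : M.+1%:R = n%:R - i%:R - 1 :> R.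
  have : (M.+2 + i)%:R = n%:R :> R by rewrite -EM subnK //; lia.
  rewrite natrD -natr1; lra.
have MK : (M.+2 - k)%:R = n%:R - i%:R - k%:R :> R.
  by rewrite natrB; [rewrite -[M.+2%:R]natr1 M1; ring|lia].
have -> : k%:R * ((1 + 52 / 100 * k%:R / n%:R + 104 / 100 * i%:R / n%:R) / n%:R - p) =
   (k%:R / n%:R + 52 / 100 * (k%:R / n%:R) ^+ 2 + 104 / 100 * (k%:R / n%:R) * (i%:R / n%:R))
   + - (k%:R * p) by field; lra.
rewrite expRD; apply: ler_pM; [|exact: exprn_ge0| |exact: one_sub_pow_expR].
  by rewrite divr_ge0.
by rewrite M1 MK; apply: step_factor_le.
Qed.

Lemma ex_nat_between (R : realType) (x y : R) : 0 <= x -> x + 1 <= y ->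
  exists d : nat, x <= d%:R <= y.
Proof.
move=> x0 xy; have /andP[h1 h2] := Num.Theory.truncn_itv x0.
exists (Num.truncn x).+1; rewrite (ltW h2) /= -natr1; lra.
Qed.

(** Removing the vertices one at a time costs about
    exp (k (1/m + k / (2 m^2) - p)) at the step from m vertices.  On average 1/m exceeds
    1/n by about d / (2 n^2), and the constant 0.52 in place of 1/2 absorbs the
    errors when k and d are at most n / 128. *)
Lemma law_tilt (R : realType) (p : R) (n d k : nat) : 0 <= p <= 1 ->
  (k * 128 <= n)%N -> (d * 128 <= n)%N ->
  law p n k <=
  expR (k%:R * d%:R / n%:R * (52 / 100 * (d%:R + k%:R) / n%:R + 1 - n%:R * p))
  * law p (n - d) k.
Proof.
move=> p01 kn; case: k kn => [|k] kn dn; first by rewrite !law0 mulr0.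
have N0 : 0 < n%:R :> R by rewrite ltr0n; lia.
elim: d dn => [|d IHd] dn; first by rewrite !(mulr0, mul0r) expR0 mul1r subn0.
apply: (le_trans (IHd _)); first by lia.
apply: (le_trans (ler_wpM2l (expR_ge0 _) (law_step_sharp p01 _ kn dn))) => //.
rewrite mulrA -expRD ler_wpM2r ?law_ge0 // ler_expR -subr_ge0 -[d.+1%:R]natr1.
rewrite [leRHS](_ : _ = 52 / 100 * k.+1%:R / n%:R ^+ 2); last by field; lra.
by rewrite divr_ge0 ?exprn_ge0 // mulr_ge0.
Qed.

(** Less precise than [law_step_sharp], but valid for every k: removing a vertex
    from m + 1 makes the mass at k grow as long as m + 1 - k exceeds 1/p. *)
Lemma law_step_crude (R : realType) (p : R) (m k : nat) : 0 <= p <= 1 -> (k <= m)%N ->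
  law p m.+1 k <= expR (- (k%:R * (p - (m.+1 - k)%:R^-1))) * law p m k.
Proof.
move=> p01 km; rewrite law_ratio //; apply: ler_wpM2r; first exact: law_ge0.
have -> : - (k%:R * (p - (m.+1 - k)%:R^-1)) = k%:R / (m.+1 - k)%:R + - (k%:R * p) by ring.
have a0 : 0 < (m.+1 - k)%:R :> R by rewrite ltr0n subn_gt0.
rewrite expRD; apply: ler_pM; rewrite ?divr_ge0 ?one_sub_pow_expR //.
  by rewrite exprn_ge0 // subr_ge0; case/andP: p01.
have aE : (m.+1 - k)%:R = m%:R + 1 - k%:R :> R by rewrite natrB ?natr1 // leqW.
apply: le_trans (expR_ge1Dx _); rewrite ler_pdivrMr // mulrDl mulfVK ?gt_eqF // aE.
lra.
Qed.

(** * The second moment from the normalization *)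

Definition moment2 (R : realType) (p : R) (n : nat) : R :=
  \sum_(k < n.+1) k%:R ^+ 2 * law p n k.

(** Since the law for n + 1 vertices has mass at most 1, the mean under P_n of
    the factor q^k n / (n + 1 - k) is at most 1.  To second order its
    logarithm is (1/n - p) k + k^2 / (2 n^2), so E K^2 / (2 n^2) is controlled
    by the mean of [K]. *)
Lemma moment2_le (R : realType) (p : R) (n : nat) : 0 <= p <= 2^-1 -> (0 < n)%N ->
  moment2 p n <= 2 * n%:R * ((p * n%:R - 1) * chi p n + 1)
                 + (2 * (p * n%:R) ^+ 2 + 2) * chi p n.
Proof.
move=> p02 n0; have p01 : 0 <= p <= 1 by lra.
have N0 : 0 < n%:R :> R by rewrite ltr0n.
set N : R := n%:R in N0 *.
have L0 k := law_ge0 n k p01.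
have H : \sum_(k < n.+1) (1 + ((k%:R - 1) / N + (k%:R ^+ 2 - 2 * k%:R) / (2 * N ^+ 2)
                        - k%:R * (p + p ^+ 2))) * law p n k <= 1.
  rewrite -[leRHS](sum_law p (ltn0Sn n)) [leRHS]big_ord_recr /=.
  apply: (@le_trans _ _ (\sum_(k < n.+1) law p n.+1 k)); last first.
    by rewrite lerDl law_ge0.
  apply: ler_sum => -[k /= lk] _.
  have [->|k0] := posnP k; first by rewrite !law0 mulr0.
  rewrite ltnS in lk; rewrite law_ratio //; apply: ler_wpM2r => //.
  set K : R := k%:R.
  have K1 : 1 <= K by rewrite ler1n.
  have KN : K <= N by rewrite ler_nat.
  set t := (K - 1) / N.
  have t0 : 0 <= t by rewrite divr_ge0 //; lra.
  have tN : t * N = K - 1 by rewrite /t mulfVK //; lra.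
  have aE : (n.+1 - k)%:R = N * (1 - t) :> R.
    by rewrite natrB ?leqW // -natr1 mulrBr mulr1 [N * t]mulrC tN /N /K; ring.
  have t1 : 0 < 1 - t.
    have := ltr0n R (n.+1 - k); rewrite subn_gt0 ltnS lk aE pmulr_rgt0 //.
  apply: (@le_trans _ _ (expR (t + t ^+ 2 / 2) * expR (- (p + p ^+ 2)) ^+ k)).
    rewrite -expRM_natl -expRD; apply: le_trans (expR_ge1Dx _).
    rewrite lerD2l -subr_ge0.
    rewrite [leRHS](_ : _ = (2 * N ^+ 2)^-1); first by rewrite invr_ge0 mulr_ge0 ?exprn_ge0 // ltW.
    by rewrite /t -/K; field; lra.
  apply: ler_pM; rewrite ?expR_ge0 ?exprn_ge0 ?expR_ge0 //.
    rewrite aE invfM mulrA divff ?gt_eqF // mul1r -[leRHS]mul1r ler_pdivlMr // mulrC.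
    exact: one_sub_expR_le1.
  apply: lerXn2r; rewrite ?nnegrE ?expR_ge0 //; first by lra.
  by apply: expR_one_sub; lra.
move: H; rewrite (eq_bigr (fun k : 'I_n.+1 => (1 - N^-1) * law p n k
  + (N^-1 - N ^- 2 - (p + p ^+ 2)) * (k%:R * law p n k)
  + (2 * N ^+ 2)^-1 * (k%:R ^+ 2 * law p n k))); last by move=> k _; field; lra.
rewrite !big_split /= -!mulr_sumr sum_law // -chiE -/(moment2 p n) mulr1 => H.
have N20 : 0 < 2 * N ^+ 2 by rewrite mulr_gt0 ?exprn_gt0.
have E : moment2 p n = 2 * N ^+ 2 * ((2 * N ^+ 2)^-1 * moment2 p n).
  by rewrite mulrA divff ?gt_eqF // mul1r.
rewrite E; apply: (@le_trans _ _ (2 * N ^+ 2 * (1 - ((1 - N^-1) + (N^-1 - N ^- 2 - (p + p ^+ 2)) * chi p n)))).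
  by rewrite ler_pM2l //; lra.
rewrite le_eqVlt; apply/orP; left; apply/eqP; field; lra.
Qed.

(** * The susceptibility in the critical window *)

Lemma chi_subcritical_le (R : realType) (p b : R) (n : nat) : 0 <= p <= 1 -> 0 < b ->
  n%:R * p <= 1 - b -> chi p n <= b^-1.
Proof.
move=> p01 b0 h; apply: (le_trans (chi_subcritical p01 _)); first by lra.
by rewrite lef_pV2 ?posrE //; lra.
Qed.

Lemma chi_widen (R : realType) (p : R) (m n : nat) : (0 < m <= n)%N ->
  \sum_(k < n.+1) k%:R * law p m k = chi p m.
Proof. by move=> mn; rewrite (@sum_law_widen _ p m n (fun k => k%:R)) // chiE. Qed.

(** Sizes above 4 b n contribute at most half of [chi n] plus 2 / b, by Markov's
    inequality for the second moment.  Smaller sizes are compared with a graph on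
    n - d vertices where d is about 1.1 b n, which is subcritical with
    margin b / 10; the exponent is then at most 13 b^3 n.  If n p is itself below
    1 - b / 10, the branching bound is enough. *)
Lemma chi_window_le (R : realType) (p b : R) (n : nat) : 0 <= p <= 2^-1 -> 0 < b <= 512^-1 ->
  1 <= b ^+ 3 * n%:R -> n%:R * p <= 1 + b ->
  chi p n <= 24 / b * expR (13 * (b ^+ 3 * n%:R)).
Proof.
move=> p02 /andP[b0 b1] bn np; have p01 : 0 <= p <= 1 by lra.
have E1 : 1 <= expR (13 * (b ^+ 3 * n%:R)) by rewrite -[leLHS]expR0 ler_expR; lra.
have bi0 : 0 < b^-1 by rewrite invr_gt0.
have [np2|np2] := leP (n%:R * p) (1 - b / 10).
  apply: (le_trans (chi_subcritical_le p01 _ np2)); first by lra.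
  by rewrite invf_div; nra.
have N0 : 0 < n%:R :> R.
  rewrite ltr0n lt0n; apply/negP => /eqP n0; move: np2; rewrite n0 mul0r; lra.
have n0 : (0 < n)%N by rewrite -(ltr0n R).
have bN : 100 <= b * n%:R.
  have b2 : b * b <= 100^-1 by nra.
  have := ler_wpM2r (mulr_ge0 (ltW b0) (ltW N0)) b2.
  have : b * b * (b * n%:R) = b ^+ 3 * n%:R by ring.
  lra.
have [d /andP[d1 d2]] := @ex_nat_between R (11 / 10 * b * n%:R) (115 / 100 * b * n%:R)
   ltac:(lra) ltac:(lra).
have dn : (d * 128 <= n)%N by rewrite -(ler_nat R) natrM; nra.
have dn1 : (d <= n)%N by rewrite (leq_trans _ dn) // leq_pmulr.
have dln : (0 < n - d <= n)%N by clear -n0 dn; lia.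
have np' : (n - d)%:R * p <= 1 - b / 10.
  rewrite natrB //.
  have h : (11 / 10 * b * n%:R) * p <= d%:R * p by rewrite ler_wpM2r //; case/andP: p01.
  have c0 : 0 <= 1 - 11 / 10 * b by lra.
  have := ler_wpM2r c0 np; have : 0 <= b * b by rewrite mulr_ge0 ?ltW.
  lra.
have chi' : chi p (n - d) <= 10 / b.
  by rewrite -invf_div; apply: chi_subcritical_le np' => //; lra.
set E := expR _ in E1 *.
have term (k : nat) : (k <= n)%N ->
   k%:R * law p n k <= (4 * b * n%:R)^-1 * (k%:R ^+ 2 * law p n k)
      + E * (k%:R * law p (n - d) k).
  move=> kn; have L0 := law_ge0 n k p01; have L1 := law_ge0 (n - d) k p01.
  have K0 : 0 <= k%:R :> R by [].
  have B0 : 0 < 4 * b * n%:R by nra.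
  have E0 : 0 <= E by lra.
  (* Markov's inequality for sizes above 4 b n, the tilt below. *)
  have [kb|kb] := leP (k%:R : R) (4 * b * n%:R); last first.
    apply: (@le_trans _ _ ((4 * b * n%:R)^-1 * (k%:R ^+ 2 * law p n k))).
      rewrite [leRHS]mulrC ler_pdivlMr //.
      by rewrite mulrAC expr2 ler_wpM2r // ler_wpM2l // ltW.
    by rewrite lerDl; apply: mulr_ge0 => //; apply: mulr_ge0.
  apply: (@le_trans _ _ (E * (k%:R * law p (n - d) k))); last first.
    rewrite lerDr; apply: mulr_ge0; first by rewrite invr_ge0 ltW.
    by apply: mulr_ge0 => //; exact: exprn_ge0.
  rewrite mulrCA; apply: ler_wpM2l => //.
  have kn' : (k * 128 <= n)%N by rewrite -(ler_nat R) natrM; nra.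
  apply: (le_trans (law_tilt p01 kn' dn)); apply: ler_wpM2r => //.
  rewrite ler_expR.
  have x0 : 0 <= k%:R * d%:R / n%:R :> R by rewrite divr_ge0 ?mulr_ge0.
  have x1 : k%:R * d%:R / n%:R <= 46 / 10 * b ^+ 2 * n%:R :> R.
    rewrite ler_pdivrMr //.
    have := ler_pM K0 (ler0n R d) kb d2; rewrite !expr2; lra.
  have y1 : 52 / 100 * (d%:R + k%:R) / n%:R + 1 - n%:R * p <= 2778 / 1000 * b.
    have : 52 / 100 * (d%:R + k%:R) / n%:R <= 2678 / 1000 * b :> R by rewrite ler_pdivrMr //; lra.
    lra.
  apply: (le_trans (ler_wpM2l x0 y1)).
  apply: (le_trans (ler_wpM2r _ x1)); first by lra.
  have b3 : 0 <= b ^+ 3 * n%:R by lra.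
  rewrite [leLHS](_ : _ = 46 / 10 * (2778 / 1000) * (b ^+ 3 * n%:R)); last by field.
  lra.
have H : chi p n <= (4 * b * n%:R)^-1 * moment2 p n + E * chi p (n - d).
  rewrite {1}chiE -(@chi_widen _ p (n - d) n) //.
  rewrite /moment2 !mulr_sumr -big_split /=; apply: ler_sum => k _.
  by apply: term; rewrite -ltnS ltn_ord.
have C1 := chi_ge1 p01 n0.
have C2 := chi_le n p01.
have M2 : moment2 p n <= 2 * n%:R * (b * chi p n) + 8 * n%:R.
  apply: (le_trans (moment2_le p02 n0)).
  have q0 : 0 <= p * n%:R by apply: mulr_ge0; lra.
  have h1 : (p * n%:R - 1) * chi p n <= b * chi p n by apply: ler_wpM2r; lra.
  have h2 : (p * n%:R) ^+ 2 <= 2 by rewrite expr2; nra.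
  have h2' := sqr_ge0 (p * n%:R).
  have h3 : (2 * (p * n%:R) ^+ 2 + 2) * chi p n <= 6 * n%:R by apply: ler_pM; lra.
  nra.
have B0 : 0 < 4 * b * n%:R by nra.
have H2 : (4 * b * n%:R)^-1 * moment2 p n <= chi p n / 2 + 2 / b.
  rewrite mulrC ler_pdivrMr //; apply: (le_trans M2).
  rewrite le_eqVlt; apply/orP; left; apply/eqP; field; lra.
have H3 : E * chi p (n - d) <= E * (10 / b) by rewrite ler_wpM2l //; lra.
have H4 : b^-1 <= b^-1 * E by rewrite ler_peMr // ltW.
rewrite [leRHS](_ : _ = 24 * (b^-1 * E)); last by ring.
have : E * (10 / b) = 10 * (b^-1 * E) by ring.
have : 2 / b = 2 * b^-1 by [].
lra.
Qed.

(** * Russo's formula *)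

Definition logder (R : realType) (p : R) (n : nat) : R :=
  (chi_poly R n)^`().[p] / chi p n.

Lemma dlog_susceptibilityE (R : realType) (n : nat) (v : 'I_n) (p : R) : 0 <= p <= 1 ->
  dlog_susceptibility v p = logder p n.
Proof.
move=> p01; have n0 : (0 < n)%N by case: n v => // -[].
have c0 : 0 < chi p n by apply: lt_le_trans (chi_ge1 p01 n0).
rewrite /dlog_susceptibility.
have -> : (fun q : R => ln (susceptibility v q)) = @ln R \o horner (chi_poly R n).
  by apply/funext => q /=; rewrite susceptibilityE.
have dl := is_derive1_ln c0; rewrite derive1E.
have dc : is_derive p 1 (@ln R \o horner (chi_poly R n))
    ((chi p n)^-1 * (chi_poly R n)^`().[p]) by exact: is_derive1_comp.
by case: dc => _ ->; rewrite mulrC.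
Qed.

Lemma russo (R : realType) (p : R) (n : nat) :
  (1 - p) * (chi_poly R n)^`().[p]
  = \sum_(k < n.+1) (k * (n - k))%:R * law p n k * chi p (n - k).
Proof.
have /(congr1 (horner^~ p)) := qderiv_chi R n.
rewrite /qderiv hornerM horner_sum.
have -> : (1 - 'X).[p] = 1 - p by rewrite !hornerE.
move=> ->; apply: eq_bigr => k _; rewrite hornerM; congr (_ * _).
by rewrite !mulr_natl hornerMn.
Qed.

(** In this form the sum on the right only needs to be compared with [chi n]. *)
Lemma russo_le (R : realType) (p : R) (n : nat) : 0 <= p <= 1 ->
  (1 - p) * (chi_poly R n)^`().[p]
  <= n%:R * \sum_(k < n.+1) k%:R * law p n k * chi p (n - k).
Proof.
move=> p01; rewrite russo mulr_sumr; apply: ler_sum => k _.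
rewrite (_ : _ * chi _ _ = (n - k)%:R * (k%:R * law p n k * chi p (n - k))).
  by rewrite ler_wpM2r ?ler_nat ?leq_subr // !mulr_ge0 ?law_ge0 ?chi_ge0.
by rewrite natrM; ring.
Qed.

Lemma logder_le (R : realType) (p a : R) (n : nat) : 0 <= p <= 2^-1 -> (0 < n)%N ->
  \sum_(k < n.+1) k%:R * law p n k * chi p (n - k) <= a * chi p n ->
  logder p n <= 2 * (a * n%:R).
Proof.
move=> p02 n0 H; have p01 : 0 <= p <= 1 by lra.
have c0 : 0 < chi p n by apply: lt_le_trans (chi_ge1 p01 n0).
rewrite /logder ler_pdivrMr //.
have H1 := le_trans (russo_le n p01) (ler_wpM2l (ler0n R n) H).
have q0 : 0 < 1 - p by lra.
rewrite -(ler_pM2l q0); apply: (le_trans H1).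
have S0 : 0 <= \sum_(k < n.+1) k%:R * law p n k * chi p (n - k).
  by apply: sumr_ge0 => k _; rewrite !mulr_ge0 ?law_ge0 ?chi_ge0.
have z0 : 0 <= n%:R * (a * chi p n) by rewrite mulr_ge0 //; exact: le_trans H.
have : (1 - p) * (2 * (a * n%:R) * chi p n) = (2 * (1 - p)) * (n%:R * (a * chi p n)) by ring.
move=> ->; rewrite ler_peMl //; lra.
Qed.

Lemma logder_le_chi (R : realType) (p : R) (n : nat) : 0 <= p <= 2^-1 -> (0 < n)%N ->
  logder p n <= 2 * (chi p n * n%:R).
Proof.
move=> p02 n0; have p01 : 0 <= p <= 1 by lra.
apply: logder_le => //; rewrite {2}chiE mulr_sumr; apply: ler_sum => k _.
rewrite mulrC ler_wpM2r ?mulr_ge0 ?law_ge0 //.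
by apply: chi_mono => //; exact: leq_subr.
Qed.

(** * The slightly supercritical regime *)

(** [law_tilt] with separate bounds b and c for the two factors of its
    exponent. *)
Lemma law_tilt_le (R : realType) (p b c : R) (n d k : nat) : 0 <= p <= 1 -> (0 < n)%N ->
  (k * 128 <= n)%N -> (d * 128 <= n)%N -> 0 <= b -> 0 <= c ->
  52 / 100 * (d%:R + k%:R) <= (n%:R * p - 1 - c) * n%:R -> b * n%:R <= k%:R * d%:R ->
  law p n k <= expR (- (b * c)) * law p (n - d) k.
Proof.
move=> p01 n0 kn dn b0 c0 H1 H2; have N0 : 0 < n%:R :> R by rewrite ltr0n.
apply: (le_trans (law_tilt p01 kn dn)); rewrite ler_wpM2r ?law_ge0 // ler_expR.
have y1 : 52 / 100 * (d%:R + k%:R) / n%:R + 1 - n%:R * p <= - c.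
  have : 52 / 100 * (d%:R + k%:R) / n%:R <= n%:R * p - 1 - c by rewrite ler_pdivrMr.
  clear; lra.
have z0 : 0 <= k%:R * d%:R / n%:R :> R by rewrite divr_ge0 ?mulr_ge0.
have x0 : b <= k%:R * d%:R / n%:R by rewrite ler_pdivlMr.
apply: (le_trans (ler_wpM2l z0 y1)); rewrite mulrN lerN2; exact: ler_wpM2r.
Qed.

(** Removing at least (7/8) e n vertices from a graph with n p = 1 + e leaves a
    graph with mean degree at most 1 + e / 8, to which [chi_window_le] applies;
    13 / 8^3 < 1 / 32. *)
Lemma chi_middle_le (R : realType) (p e : R) (n k : nat) : 0 <= p <= 2^-1 ->
  0 < e <= 150^-1 -> n%:R * p = 1 + e -> 1 <= (e / 16) ^+ 3 * n%:R ->
  (k * 2 <= n)%N -> 7 / 8 * (e * n%:R) <= k%:R ->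
  chi p (n - k) <= 192 / e * expR (e ^+ 3 * n%:R / 32).
Proof.
move=> p02 /andP[e0 e1] np en kn kl.
have b1 : 0 < e / 8 <= 512^-1 by clear -e0 e1; apply/andP; split; lra.
have nk : (n - k)%:R = n%:R - k%:R :> R by rewrite natrB //; clear -kn; lia.
have kn' : k%:R * 2 <= n%:R :> R by rewrite -natrM ler_nat.
have e30 : 0 <= e ^+ 3 by apply: exprn_ge0; exact: ltW.
have E8 : (e / 8) ^+ 3 * (n - k)%:R = e ^+ 3 * (n%:R - k%:R) / 512 by rewrite nk; field.
have E16 : (e / 16) ^+ 3 * n%:R = e ^+ 3 * n%:R / 4096 by field.
have Hk := ler_wpM2l e30 kn'.
have k3 : 0 <= e ^+ 3 * k%:R by exact: mulr_ge0.
have X2 : 1 <= (e / 8) ^+ 3 * (n - k)%:R.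
  by rewrite E8; rewrite E16 in en; clear -en Hk k3; lra.
have X3 : (n - k)%:R * p <= 1 + e / 8.
  have p0 : 0 <= p by case/andP: p02.
  have := ler_wpM2r p0 kl.
  have : 7 / 8 * (e * n%:R) * p = 7 / 8 * (e + e * e) by rewrite -!mulrA np; field.
  have : 0 <= e * e by apply: mulr_ge0; exact: ltW.
  rewrite nk mulrBl np; clear -e0; lra.
apply: (le_trans (chi_window_le p02 b1 X2 X3)).
have -> : 24 / (e / 8) = 192 / e by field; clear -e0; lra.
apply: ler_wpM2l; first by apply: divr_ge0; [exact: ler0n|exact: ltW].
by rewrite E8 ler_expR; clear -Hk k3; lra.
Qed.

(** The three terms on the right are meant for sizes k below (7/8) e n, between
    (7/8) e n and (9/8) e n, and above (9/8) e n.  Removing d1 vertices makes the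
    graph subcritical with margin (3/100) e while the tilt is still at most 1 for the small sizes.
    Removing d2 vertices gains exp (- e^3 n / 32) for the middle sizes, exactly
    what [chi_middle_le] loses. *)
Lemma supercritical_term_le (R : realType) (p e : R) (n d1 d2 k : nat) : 0 <= p <= 2^-1 ->
  0 < e <= 150^-1 -> n%:R * p = 1 + e -> 1 <= (e / 16) ^+ 3 * n%:R ->
  103 / 100 * (e * n%:R) <= d1%:R <= 104 / 100 * (e * n%:R) ->
  49 / 100 * (e * n%:R) <= d2%:R <= 50 / 100 * (e * n%:R) -> (k <= n)%N ->
  k%:R * law p n k * chi p (n - k) <=
     chi p n * (k%:R * law p (n - d1) k) + (192 / e) * (k%:R * law p (n - d2) k)
     + (8 / e) * (k%:R * law p n k).
Proof.
move=> p02 e01 np en /andP[d1l d1u] /andP[d2l d2u] kn.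
have [e0 e1] := andP e01; have p01 : 0 <= p <= 1 by clear -p02; lra.
have p0 : 0 <= p by case/andP: p01.
have n0 : (0 < n)%N.
  rewrite lt0n; apply/negP => /eqP n0; move: np; rewrite n0 mul0r; clear -e0; lra.
have N0 : 0 < n%:R :> R by rewrite ltr0n.
have eN1 : e * n%:R <= n%:R / 150 by rewrite mulrC ler_wpM2l // ltW.
have d1n : (d1 * 128 <= n)%N by rewrite -(ler_nat R) natrM; clear -eN1 d1u N0; lra.
have d2n : (d2 * 128 <= n)%N by rewrite -(ler_nat R) natrM; clear -eN1 d2u N0; lra.
have L0 := law_ge0 n k p01; have L1 := law_ge0 (n - d1) k p01.
have L2 := law_ge0 (n - d2) k p01.
have K0 : 0 <= k%:R :> R by [].
have C0 := chi_ge0 n p01; have C1 := chi_ge0 (n - k) p01.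
have c8 : 0 <= 8 / e by apply: divr_ge0; [exact: ler0n|exact: ltW].
have c192 : 0 <= 192 / e by apply: divr_ge0; [exact: ler0n|exact: ltW].
have P1 : 0 <= chi p n * (k%:R * law p (n - d1) k) by do 2! apply: mulr_ge0 => //.
have P2 : 0 <= (192 / e) * (k%:R * law p (n - d2) k) by do 2! apply: mulr_ge0 => //.
have P3 : 0 <= (8 / e) * (k%:R * law p n k) by do 2! apply: mulr_ge0 => //.
have M0 : 0 <= e * n%:R by apply: mulr_ge0; exact: ltW.
have [kl|kl] := leP (k%:R : R) (7 / 8 * (e * n%:R)).
  suff : k%:R * law p n k * chi p (n - k) <= chi p n * (k%:R * law p (n - d1) k).
    by clear -P2 P3; lra.
  rewrite [leRHS]mulrC; apply: ler_pM => //; first exact: mulr_ge0.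
    apply: ler_wpM2l => //.
    have kn' : (k * 128 <= n)%N by rewrite -(ler_nat R) natrM; clear -eN1 kl N0; lra.
    have := @law_tilt_le R p 0 0 n d1 k p01 n0 kn' d1n (lexx _) (lexx _).
    rewrite [0 * 0]mul0r oppr0 expR0 mul1r; apply; last by rewrite mul0r mulr_ge0.
    by rewrite np; clear -kl d1u M0; lra.
  by apply: chi_mono => //; exact: leq_subr.
have kp : 7 / 8 * (e * n%:R) * p = 7 / 8 * (e + e * e) by rewrite -!mulrA np; field.
have ee0 : 0 <= e * e by apply: mulr_ge0; exact: ltW.
have [kh|kh] := leP (9 / 8 * (e * n%:R)) (k%:R : R).
  suff : k%:R * law p n k * chi p (n - k) <= (8 / e) * (k%:R * law p n k).
    by clear -P1 P2; lra.
  rewrite mulrC; apply: ler_wpM2r; first exact: mulr_ge0.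
  have -> : 8 / e = (e / 8)^-1 by rewrite invf_div.
  apply: chi_subcritical_le => //; first by apply: divr_gt0.
  rewrite natrB // mulrBl np; have := ler_wpM2r p0 kh.
  have : 9 / 8 * (e * n%:R) * p = 9 / 8 * (e + e * e) by rewrite -!mulrA np; field.
  by clear -ee0; lra.
suff : k%:R * law p n k * chi p (n - k) <= (192 / e) * (k%:R * law p (n - d2) k).
  by clear -P1 P3; lra.
have kn' : (k * 128 <= n)%N by rewrite -(ler_nat R) natrM; clear -eN1 kh N0; lra.
have kn2 : (k * 2 <= n)%N by clear -kn'; lia.
have CM := chi_middle_le p02 e01 np en kn2 (ltW kl).
have X0 : 0 <= e ^+ 3 * n%:R by apply: mulr_ge0 => //; apply: exprn_ge0; exact: ltW.
have LM : law p n k <= expR (- (e ^+ 3 * n%:R / 32)) * law p (n - d2) k.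
  have b0 : 0 <= 42 / 100 * (e * (e * n%:R)).
    by apply: mulr_ge0; [clear; lra|apply: mulr_ge0 => //; exact: ltW].
  have c0 : 0 <= 15 / 100 * e by clear -e0; lra.
  have h1 : 52 / 100 * (d2%:R + k%:R) <= (n%:R * p - 1 - 15 / 100 * e) * n%:R.
    by rewrite np; clear -kh d2u M0; lra.
  have h2 : 42 / 100 * (e * (e * n%:R)) * n%:R <= k%:R * d2%:R.
    have a0 : 0 <= 7 / 8 * (e * n%:R) by clear -M0; lra.
    have b1 : 0 <= 49 / 100 * (e * n%:R) by clear -M0; lra.
    have := ler_pM a0 b1 (ltW kl) d2l.
    have : 0 <= (e * n%:R) * (e * n%:R) by exact: mulr_ge0.
    by clear; lra.
  apply: (le_trans (law_tilt_le p01 n0 kn' d2n b0 c0 h1 h2)).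
  rewrite ler_wpM2r // ler_expR.
  have -> : 42 / 100 * (e * (e * n%:R)) * (15 / 100 * e) = 63 / 1000 * (e ^+ 3 * n%:R) by field.
  by clear -X0; lra.
apply: (@le_trans _ _ (k%:R * (expR (- (e ^+ 3 * n%:R / 32)) * law p (n - d2) k) *
    (192 / e * expR (e ^+ 3 * n%:R / 32)))).
  by apply: ler_pM => //; [exact: mulr_ge0|apply: ler_wpM2l].
rewrite expRN; set E := expR _; set c := 192 / e.
have E0 : E != 0 by rewrite gt_eqF // expR_gt0.
by rewrite le_eqVlt; apply/orP; left; apply/eqP; field.
Qed.

Lemma logder_supercritical (R : realType) (p e : R) (n : nat) : 0 <= p <= 2^-1 ->
  0 < e <= 150^-1 -> n%:R * p = 1 + e -> 1 <= (e / 16) ^+ 3 * n%:R ->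
  logder p n <= 500 * (n%:R / e).
Proof.
move=> p02 e01 np en; have p01 : 0 <= p <= 1 by clear -p02; lra.
have [e0 e1] := andP e01; have p0 : 0 <= p by case/andP: p01.
have n0 : (0 < n)%N.
  rewrite lt0n; apply/negP => /eqP n0; move: np; rewrite n0 mul0r; clear -e0; lra.
have N0 : 0 < n%:R :> R by rewrite ltr0n.
have M0 : 0 <= e * n%:R by apply: mulr_ge0; exact: ltW.
have eN : 100 <= e * n%:R.
  have e2 : e * e <= 1 by clear -e0 e1; nra.
  have := ler_wpM2r M0 e2.
  have : (e / 16) ^+ 3 * n%:R = e * e * (e * n%:R) / 4096 by field.
  by clear -en; lra.
have [d1 d1b] := @ex_nat_between R (103 / 100 * (e * n%:R)) (104 / 100 * (e * n%:R))
   ltac:(clear -eN; lra) ltac:(clear -eN; lra).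
have [d2 d2b] := @ex_nat_between R (49 / 100 * (e * n%:R)) (50 / 100 * (e * n%:R))
   ltac:(clear -eN; lra) ltac:(clear -eN; lra).
have eN1 : e * n%:R <= n%:R / 150 by rewrite mulrC ler_wpM2l // ltW.
have [d1l d1u] := andP d1b; have [d2l d2u] := andP d2b.
have d1n : (d1 * 128 <= n)%N by rewrite -(ler_nat R) natrM; clear -eN1 d1u N0; lra.
have d2n : (d2 * 128 <= n)%N by rewrite -(ler_nat R) natrM; clear -eN1 d2u N0; lra.
have m1 : (0 < n - d1 <= n)%N by clear -n0 d1n; lia.
have m2 : (0 < n - d2 <= n)%N by clear -n0 d2n; lia.
have mn : (0 < n <= n)%N by rewrite n0 leqnn.
have ei0 : 0 < e^-1 by rewrite invr_gt0.
have C0 := chi_ge0 n p01.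
have H : \sum_(k < n.+1) k%:R * law p n k * chi p (n - k) <= (234 / e) * chi p n.
  apply: (@le_trans _ _ (chi p n * chi p (n - d1) + 192 / e * chi p (n - d2) + 8 / e * chi p n)).
    rewrite -(chi_widen p m1) -(chi_widen p m2) -[X in 8 / e * X](chi_widen p mn).
    rewrite !mulr_sumr -!big_split /=; apply: ler_sum => k _.
    by apply: supercritical_term_le => //; rewrite -ltnS ltn_ord.
  have c1 : chi p (n - d1) <= 34 / e.
    have : chi p (n - d1) <= (3 / 100 * e)^-1.
      apply: chi_subcritical_le => //; first by clear -e0; lra.
      rewrite natrB; last by case/andP: m1 => _; clear -d1n; lia.
      have := ler_wpM2r p0 d1l.
      have : 103 / 100 * (e * n%:R) * p = 103 / 100 * (e + e * e) by rewrite -!mulrA np; field.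
      have : 0 <= e * e by apply: mulr_ge0; exact: ltW.
      by rewrite mulrBl np; clear -e0; lra.
    have -> : (3 / 100 * e)^-1 = 100 / 3 / e by field; clear -e0; lra.
    by clear -ei0; lra.
  have c2 : chi p (n - d2) <= chi p n by apply: chi_mono => //; exact: leq_subr.
  have := ler_wpM2l C0 c1.
  have : 192 / e * chi p (n - d2) <= 192 / e * chi p n.
    by apply: ler_wpM2l => //; apply: divr_ge0; [exact: ler0n|exact: ltW].
  by clear; lra.
apply: (le_trans (logder_le p02 n0 H)).
by have := mulr_gt0 N0 ei0; clear; lra.
Qed.

(** * The dense regime *)

Lemma pow_expR_bounded (R : realType) (m : nat) (c : R) : 0 < c ->
  exists2 C : R, 0 < C & forall y, 0 <= y -> y ^+ m * expR (- (c * y)) <= C.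
Proof.
move=> c0; have f0 : 0 < m`!%:R :> R by rewrite ltr0n fact_gt0.
exists (1 + m`!%:R / c ^+ m); first by apply: addr_gt0 => //; apply: divr_gt0 => //; exact: exprn_gt0.
move=> y y0; have cy0 : 0 <= c * y by apply: mulr_ge0 => //; exact: ltW.
rewrite expRN ler_pdivrMr ?expR_gt0 //.
case: m f0 => [|m] f0.
  rewrite expr0; have : 1 <= expR (c * y) by rewrite -[leLHS]expR0 ler_expR.
  move=> h; apply: (le_trans h); rewrite ler_peMl ?expR_ge0 // lerDl divr_ge0 //.
apply: (@le_trans _ _ (m.+1`!%:R / c ^+ m.+1 * expR (c * y))); last first.
  by rewrite ler_wpM2r ?expR_ge0 // lerDr.
have cm0 : 0 < c ^+ m.+1 by exact: exprn_gt0.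
have := @expR_ge1Dxn R (c * y) m cy0; set E := expR _ => h.
have {}h : (c * y) ^+ m.+1 / m.+1`!%:R <= E by apply: le_trans h; rewrite lerDr.
rewrite mulrAC ler_pdivlMr // mulrC -exprMn -ler_pdivrMl //.
by rewrite mulrC.
Qed.

Lemma law_le1 (R : realType) (p : R) (n k : nat) : 0 <= p <= 1 -> (0 < n)%N -> law p n k <= 1.
Proof.
move=> p01 n0; have [kn|nk] := leqP k n; last by rewrite law_small ?n0.
have kn' : (k < n.+1)%N by [].
rewrite -(sum_law p n0) (bigD1 (Ordinal kn')) //= lerDl.
by apply: sumr_ge0 => i _; exact: law_ge0.
Qed.

Lemma law_le_bin (R : realType) (p : R) (n k : nat) : 0 <= p <= 1 -> (0 < k)%N ->
  law p n k <= 'C(n.-1, k.-1)%:R * (1 - p) ^+ (k * (n - k)).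
Proof.
move=> p01 k0; have := law_le1 k p01 k0.
rewrite /law /comp_law binn subnn muln0 expr0 mulr1 mul1r => ck.
rewrite mulr_natl mulrnAl hornerMn !hornerE -mulrnAl -mulr_natl.
apply: ler_wpM2r; first by rewrite exprn_ge0 // subr_ge0; case/andP: p01.
by rewrite ler_piMr.
Qed.

Lemma bin_le_exp (n k : nat) : ('C(n, k) <= n ^ k)%N.
Proof.
case: (leqP k n) => kn; last by rewrite bin_small.
rewrite -(leq_pmul2r (fact_gt0 k)) bin_ffact.
apply: (@leq_trans (n ^ k)); last by rewrite leq_pmulr ?fact_gt0.
elim: k kn => [|k IHk] kn; first by rewrite ffactn0 expn0.
by rewrite ffactnSr expnSr leq_mul ?IHk ?leq_subr // ltnW.
Qed.

(** A union bound: of the k (n - k) absent edges one pays for the factor 1 - p,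
    and the others, at least n min (k, n - k) / 4 in number, beat the binomial
    coefficient. *)
Lemma law_le_dense (R : realType) (p : R) (n k : nat) : 0 <= p <= 1 -> (4 <= n)%N ->
  (0 < k < n)%N -> n%:R * expR (- (4^-1 * (n%:R * p))) <= 1 ->
  law p n k <= (1 - p) * (n%:R * expR (- (4^-1 * (n%:R * p)))).
Proof.
move=> p01 n4 /andP[k0 kn] Hn; have p0 : 0 <= p by case/andP: p01.
have q0 : 0 <= 1 - p by rewrite subr_ge0; case/andP: p01.
set j := minn k (n - k).
have j0 : (0 < j)%N by rewrite /j leq_min k0 subn_gt0.
have kj : (j * n <= k * (n - k) * 2)%N by rewrite /j; case: leqP; nia.
have binj : ('C(n.-1, k.-1) <= n ^ j)%N.
  have h1 : ('C(n.-1, k.-1) <= n ^ k)%N.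
    apply: (leq_trans (bin_le_exp _ _)); apply: (@leq_trans (n ^ k.-1)).
      by case: k.-1 => // e; rewrite leq_exp2r // leq_pred.
    by rewrite leq_pexp2l ?leq_pred // (leq_trans _ n4).
  have h2 : ('C(n.-1, k.-1) <= n ^ (n - k))%N.
    have -> : 'C(n.-1, k.-1) = 'C(n.-1, n - k).
      by rewrite -bin_sub; [congr 'C(_, _); lia|lia].
    apply: (leq_trans (bin_le_exp _ _)).
    by case: (n - k)%N => // e; rewrite leq_exp2r // leq_pred.
  by rewrite /j /minn; case: ifP.
apply: (le_trans (law_le_bin _ p01 k0)).
have -> : (k * (n - k) = (k * (n - k)).-1.+1)%N by rewrite prednK // muln_gt0 k0 subn_gt0.
rewrite exprS mulrCA; apply: ler_wpM2l => //.
apply: (@le_trans _ _ ((n%:R * expR (- (4^-1 * (n%:R * p)))) ^+ j)); last first.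
  by rewrite -[leRHS]expr1; apply: ler_wiXn2l => //; rewrite mulr_ge0 ?expR_ge0.
rewrite exprMn; apply: ler_pM => //; first exact: exprn_ge0.
  by rewrite -natrX ler_nat.
apply: (le_trans (one_sub_pow_expR _ p01)); rewrite -expRM_natl ler_expR.
rewrite mulrN lerN2 !mulrA; apply: ler_wpM2r => //.
rewrite -mulrA mulrCA ler_pdivrMl // -!natrM ler_nat.
have : (4 <= j * n)%N by apply: (leq_trans n4); rewrite leq_pmull.
have : (0 < k * (n - k))%N by rewrite muln_gt0 k0 subn_gt0.
move: kj; move: (k * (n - k))%N (j * n)%N; clear; lia.
Qed.

(** The factor 1 - p in the masses of all sizes k < n compensates the one in
    Russo's formula, so that the bound holds up to p = 1. *)
Lemma logder_dense (R : realType) : exists2 C : R, 0 < C &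
  forall (n : nat) (p : R), 0 < p < 1 -> C <= n%:R -> (4 <= n)%N -> 1 <= p ^+ 2 * n%:R ->
  logder p n <= C.
Proof.
have [C C0 HC] := @pow_expR_bounded R 8 4^-1 ltac:(by rewrite invr_gt0).
exists C => // n p /andP[p0 p1] Cn n4 pn.
have p01 : 0 <= p <= 1 by rewrite !ltW.
have n0 : (0 < n)%N by apply: leq_trans n4.
have N1 : 1 <= n%:R :> R by rewrite ler1n.
have N0 : 0 < n%:R :> R by rewrite ltr0n.
set E := expR (- (4^-1 * (n%:R * p))).
have E0 : 0 <= E by exact: expR_ge0.
have H4 : n%:R ^+ 4 * E <= C.
  have y0 : 0 <= n%:R * p by apply: mulr_ge0; exact: ltW.
  apply: le_trans (HC _ y0); apply: ler_wpM2r => //.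
  have -> : (n%:R * p) ^+ 8 = n%:R ^+ 4 * (p ^+ 2 * n%:R) ^+ 4 by ring.
  by rewrite ler_peMr ?exprn_ege1 // exprn_ge0.
have n1E : n%:R * E <= 1.
  rewrite -(ler_pM2l C0) mulr1; apply: le_trans H4.
  have -> : n%:R ^+ 4 * E = n%:R ^+ 3 * (n%:R * E) by ring.
  apply: ler_wpM2r; first exact: mulr_ge0.
  by apply: (le_trans Cn); rewrite -[leLHS]expr1 ler_weXn2l.
have q0 : 0 < 1 - p by rewrite subr_gt0.
have c0 : 0 < chi p n by apply: lt_le_trans (chi_ge1 p01 n0).
rewrite /logder ler_pdivrMr // -(ler_pM2l q0) russo.
apply: (@le_trans _ _ (\sum_(k < n.+1) if (0 < k)%N && (k < n)%N
                         then n%:R ^+ 2 * ((1 - p) * (n%:R * E)) * chi p n else 0)).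
  apply: ler_sum => -[k /= lk] _; case: ifP => [/andP[k0 kn]|/negbT].
    apply: ler_pM; rewrite ?mulr_ge0 ?law_ge0 ?chi_ge0 //.
      apply: ler_pM; rewrite ?law_ge0 //; last by apply: law_le_dense => //; rewrite k0.
      by rewrite -natrX ler_nat -mulnn leq_mul ?leq_subr // ltnW.
    by apply: chi_mono => //; exact: leq_subr.
  rewrite negb_and -!leqNgt leqn0 => /orP[/eqP->|nk]; first by rewrite mul0n !mul0r.
  by have -> : (n - k = 0)%N; [apply/eqP; rewrite subn_eq0|rewrite muln0 !mul0r].
have Z0 : 0 <= n%:R ^+ 2 * ((1 - p) * (n%:R * E)) * chi p n.
  apply: mulr_ge0; last exact: ltW.
  apply: mulr_ge0; first exact: exprn_ge0.
  by apply: mulr_ge0; [exact: ltW|exact: mulr_ge0].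
apply: (@le_trans _ _ (n%:R * (n%:R ^+ 2 * ((1 - p) * (n%:R * E)) * chi p n))).
  rewrite big_ord_recl /= add0r; set Z := _ * chi p n in Z0 *.
  have -> : n%:R * Z = \sum_(i < n) Z by rewrite sumr_const card_ord mulr_natl.
  by apply: ler_sum => k _; case: ifP.
have -> : n%:R * (n%:R ^+ 2 * ((1 - p) * (n%:R * E)) * chi p n)
   = (1 - p) * ((n%:R ^+ 4 * E) * chi p n) by ring.
by apply: ler_wpM2l; [exact: ltW|apply: ler_wpM2r => //; exact: ltW].
Qed.

(** * The macroscopic supercritical regime *)

Lemma mul_expRN_le (R : realType) (c x : R) : 0 < c -> 0 <= x ->
  x * expR (- (c * x)) <= c^-1.
Proof.
move=> c0 x0; rewrite expRN ler_pdivrMr ?expR_gt0 // -ler_pdivrMl ?invr_gt0 // invrK.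
by apply: le_trans (expR_ge1Dx _); rewrite lerDr.
Qed.

(** Applied to 1 / (1 + x) = 1 - t with t = x / (1 + x). *)
Lemma one_add_expR_le (R : realType) (x : R) : 0 <= x <= 2^-1 ->
  1 + x <= expR (x - x ^+ 2 / 16).
Proof.
move=> /andP[x0 x1].
have d0 : 0 < 1 + x by lra.
pose t := x / (1 + x).
have tE : t * (1 + x) = x by rewrite /t mulfVK // gt_eqF.
have t0 : 0 <= t by apply: divr_ge0 => //; exact: ltW.
have t3 : t <= 3^-1 by rewrite /t ler_pdivrMr //; lra.
clearbody t.
have tI : (1 - t) * (1 + x) = 1 by rewrite mulrBl mul1r tE; ring.
have H := @one_sub_expR_ge1 R (3 / 4) t ltac:(lra) t0 ltac:(clear -t3; lra).
have h1 : 1 + x <= expR (t + 3 / 4 * t ^+ 2).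
  have := ler_wpM2l (ltW d0) H; rewrite mulr1 mulrA [X in X * _]mulrC tI mul1r; exact.
apply: (le_trans h1); rewrite ler_expR.
have xE : x = t + t * x by rewrite -[LHS]tE; ring.
have tx : t * x <= t * 2^-1 by rewrite ler_wpM2l.
have x2 : x ^+ 2 <= t ^+ 2 * (9 / 4).
  have -> : x ^+ 2 = t ^+ 2 * (1 + x) ^+ 2 by rewrite -exprMn tE.
  by rewrite ler_wpM2l ?sqr_ge0 // expr2; clear -x0 x1; nra.
have tt : t * t <= t * x.
  by rewrite ler_wpM2l //; have := mulr_ge0 t0 x0; clear -xE; lra.
rewrite !expr2 in x2 *; have := sqr_ge0 t; rewrite expr2; clear -x2 tt xE; lra.
Qed.

(** As long as at least (1 + g) / p vertices lie outside the component, each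
    removed vertex gains a factor exp (- k p g / 2); about g / p of them can be
    removed. *)
Lemma law_far_below (R : realType) (p g : R) (n d k : nat) : 0 < p <= 1 -> 0 < g <= 1 ->
  g / (2 * p) <= d%:R <= g / p -> (1 + 2 * g) / p <= n%:R - k%:R -> (d < n)%N ->
  law p n k <= expR (- (g ^+ 2 / 8 * k%:R)) * law p (n - d) k.
Proof.
move=> /andP[p0 p1] /andP[g0 g1] /andP[dl du] nk dn.
have p01 : 0 <= p <= 1 by rewrite ltW.
have K0 : 0 <= k%:R :> R by [].
apply: (le_trans (@law_descent_le R p (expR (- (k%:R * (p * g / 2)))) n d k _ (ltnW dn) _)).
- exact: expR_ge0.
- move=> m /andP[m1 m2].
  have nd : (n - d)%:R = n%:R - d%:R :> R by rewrite natrB // ltnW.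
  have mR : n%:R - d%:R <= m%:R :> R by rewrite -nd ler_nat.
  have h : (1 + g) / p <= n%:R - d%:R - k%:R.
    have : (1 + 2 * g) / p = (1 + g) / p + g / p by field; rewrite gt_eqF.
    by clear -nk du; lra.
  have i0 : 0 < (1 + g) / p by apply: divr_gt0 => //; clear -g0; lra.
  have km : (k <= m)%N by rewrite -(ler_nat R); clear -mR h i0; lra.
  apply: (le_trans (law_step_crude p01 km)).
  rewrite ler_wpM2r ?law_ge0 // ler_expR lerN2; apply: ler_wpM2l => //.
  have mk : (m.+1 - k)%:R = m%:R + 1 - k%:R :> R by rewrite natrB ?natr1 // leqW.
  have : (m.+1 - k)%:R^-1 <= p / (1 + g).
    rewrite -[leRHS]invf_div lef_pV2 ?posrE // mk.
      by clear -mR h; lra.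
    by clear -mR h i0; lra.
  have : p / (1 + g) <= p * (1 - g / 2).
    rewrite ler_pdivrMr; last by clear -g0; lra.
    rewrite -mulrA; rewrite -[leLHS]mulr1; apply: ler_wpM2l; first exact: ltW.
    by clear -g0 g1; nra.
  by clear; lra.
rewrite -expRM_natl ler_wpM2r ?law_ge0 // ler_expR mulrN lerN2 mulrCA.
rewrite mulrC ler_wpM2l //.
have := ler_wpM2r (ltW p0) dl.
have -> : g / (2 * p) * p = g / 2 by field; rewrite gt_eqF.
move=> h; have := ler_wpM2r (ltW g0) h; rewrite expr2.
have := mulr_ge0 (ltW g0) (ltW g0); clear; lra.
Qed.

(** When about 1/p vertices lie outside the component, the factor of one removal
    is about a exp (1 - a) with a = n p, which is below 1 because a is bounded away
    from 1. *)
Lemma law_near_dual (R : realType) (p g e : R) (n d k : nat) : 0 < p <= 1 -> 0 < g <= 4^-1 ->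
  0 < e <= 2^-1 -> 6 * g <= e ^+ 2 / 32 -> 1 + e <= n%:R * p ->
  d%:R <= g / p -> (1 - g) / p <= n%:R - k%:R <= (1 + 2 * g) / p -> (d < n)%N ->
  law p n k <= expR (- (e ^+ 2 / 32)) ^+ d * law p (n - d) k.
Proof.
move=> /andP[p0 p1] /andP[g0 g1] /andP[e0 e1] ge np du /andP[nkl nku] dn.
have p01 : 0 <= p <= 1 by rewrite ltW.
apply: law_descent_le; [exact: expR_ge0|exact: ltnW|move=> m /andP[m1 m2]].
have nd : (n - d)%:R = n%:R - d%:R :> R by rewrite natrB // ltnW.
have mR : n%:R - d%:R <= m%:R :> R by rewrite -nd ler_nat.
have mn : m%:R <= n%:R :> R by rewrite ler_nat ltnW.
have h : (1 - 2 * g) / p <= n%:R - d%:R - k%:R.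
  have : (1 - g) / p = (1 - 2 * g) / p + g / p by field; rewrite gt_eqF.
  by clear -nkl du; lra.
have i0 : 0 < (1 - 2 * g) / p by apply: divr_gt0 => //; clear -g1; lra.
have km : (k <= m)%N by rewrite -(ler_nat R); clear -mR h i0; lra.
have mk : (m.+1 - k)%:R = m%:R + 1 - k%:R :> R by rewrite natrB ?natr1 // leqW.
have N0 : 0 <= n%:R * p by clear -np e0; lra.
rewrite law_ratio //; apply: ler_wpM2r; first exact: law_ge0.
set a := n%:R * p in np N0.
have f1 : m%:R / (m.+1 - k)%:R <= a / (1 - 2 * g).
  rewrite mk ler_pdivrMr; last by clear -mR h i0; lra.
  have : a / (1 - 2 * g) * ((1 - 2 * g) / p) = n%:R.
    by rewrite /a; field; rewrite ?gt_eqF //; clear -g1; lra.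
  have z0 : 0 <= a / (1 - 2 * g) by apply: divr_ge0 => //; clear -g1; lra.
  have h' : (1 - 2 * g) / p <= m%:R + 1 - k%:R by clear -mR h; lra.
  have := ler_wpM2l z0 h'; clear -mn; lra.
have f2 : (1 - p) ^+ k <= expR (- (a - (1 + 2 * g))).
  apply: (le_trans (one_sub_pow_expR _ p01)); rewrite ler_expR lerN2.
  have := ler_wpM2r (ltW p0) nku; rewrite mulrBl mulfVK ?gt_eqF // -/a; clear; lra.
have f3 : a <= expR (e - e ^+ 2 / 16) * expR (a - 1 - e).
  have u1 : 1 + e <= expR (e - e ^+ 2 / 16) by apply: one_add_expR_le; rewrite ltW.
  have u2 := expR_ge1Dx (a - 1 - e).
  apply: (@le_trans _ _ ((1 + e) * (1 + (a - 1 - e)))).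
    have : 0 <= e * (a - 1 - e) by apply: mulr_ge0; [exact: ltW|clear -np; lra].
    by clear; lra.
  by apply: ler_pM => //; clear -np e0; lra.
have f4 : (1 - 2 * g)^-1 <= expR (4 * g).
  rewrite -[4 * g]opprK expRN lef_pV2 ?posrE ?expR_gt0 //; last by clear -g1; lra.
  apply: (le_trans _ (expR_one_sub _)); last by apply/andP; clear -g0 g1; split; lra.
  rewrite ler_expR lerN2; have := mulr_ge0 (ltW g0) (ltW g0); rewrite expr2; clear -g0 g1; nra.
apply: (@le_trans _ _ ((expR (e - e ^+ 2 / 16) * expR (a - 1 - e) * expR (4 * g))
   * expR (- (a - (1 + 2 * g))))).
  apply: ler_pM => //; rewrite ?divr_ge0 //.
    by rewrite exprn_ge0 // subr_ge0.
  apply: (le_trans f1); apply: ler_pM => //; rewrite invr_ge0; clear -g1; lra.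
rewrite -!expRD ler_expR; clear -ge; lra.
Qed.

(** Again three ranges.  Either n - k is below (1 - g) / p and the remaining graph is
    subcritical, or the mass at k is at most exp (- c k) or exp (- c / p)
    times a mass of the law for n - d vertices, whose sum is 1. *)
Lemma logder_macroscopic (R : realType) (e : R) : 0 < e <= 2^-1 -> exists2 C : R, 0 < C &
  forall (n : nat) (p : R), C * p <= 1 -> 0 < p -> 1 + e <= n%:R * p ->
    p ^+ 2 * n%:R <= 1 -> logder p n <= C * n%:R.
Proof.
move=> e01; have /andP[e0 e1] := e01.
(* Half of the gain e^2 / 16 of [one_add_expR_le] has to dominate the losses 6 g. *)
pose g := e ^+ 2 / 192.
have e2 : 0 < e ^+ 2 by exact: exprn_gt0.
have e2' : e ^+ 2 <= 4^-1 by rewrite expr2; clear -e0 e1; nra.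
have g0 : 0 < g by rewrite /g; clear -e2; lra.
have g1 : g <= 4^-1 by rewrite /g; clear -e2'; lra.
have ge : 6 * g <= e ^+ 2 / 32 by rewrite /g; clear; lra.
pose c := e ^+ 2 / 32 * (g / 2).
have c0 : 0 < c by rewrite /c; apply: mulr_gt0; rewrite divr_gt0.
have [C2 C20 HC2] := @pow_expR_bounded R 2 c c0.
pose c1 := g ^+ 2 / 8.
have c10 : 0 < c1 by rewrite /c1 divr_gt0 // exprn_gt0.
have gi0 : 0 < g^-1 by rewrite invr_gt0.
have ci0 : 0 < c1^-1 by rewrite invr_gt0.
pose A := g^-1 + c1^-1 + C2.
have A0 : 0 < A by rewrite /A; clear -gi0 ci0 C20; lra.
exists (2 * A + 2 / g + 2); first by clear -A0 gi0; lra.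
move=> n p Cp p0 np pn.
have pA : 0 <= p * A by apply: mulr_ge0; exact: ltW.
have pg0 : 0 <= p * g^-1 by apply: mulr_ge0; exact: ltW.
have p2 : p <= 2^-1 by clear -Cp pA pg0; lra.
have pg : p * g^-1 <= 2^-1 by clear -Cp pA p0; lra.
have p02 : 0 <= p <= 2^-1 by rewrite ltW.
have p01 : 0 <= p <= 1 by clear -p02; lra.
have p01' : 0 < p <= 1 by apply/andP; split; [|case/andP: p01].
have n0 : (0 < n)%N.
  rewrite lt0n; apply/negP => /eqP n0; move: np; rewrite n0 mul0r; clear -e0; lra.
have N0 : 0 < n%:R :> R by rewrite ltr0n.
have gp : 1 <= g / (2 * p).
  rewrite ler_pdivlMr; last by clear -p0; lra.
  have : (p * g^-1) * g = p by rewrite mulfVK // gt_eqF.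
  have := ler_wpM2r (ltW g0) pg; clear; lra.
have [d /andP[dl du]] := @ex_nat_between R (g / (2 * p)) (g / p)
   ltac:(clear -gp; lra)
   ltac:(have : g / p = 2 * (g / (2 * p)) by [field; rewrite gt_eqF]; clear -gp; lra).
have dn : (d < n)%N.
  rewrite -(ltr_nat R); apply: (le_lt_trans du); rewrite ltr_pdivrMr //; clear -np e0 g1; lra.
have nd0 : (0 < n - d)%N by rewrite subn_gt0.
have nd1 : (0 < n - d <= n)%N by rewrite nd0 leq_subr.
have term (k : nat) : (k <= n)%N -> k%:R * law p n k * chi p (n - k) <=
   g^-1 * (k%:R * law p n k) + chi p n * ((c1^-1 + C2) * law p (n - d) k).
  move=> kn; have L0 := law_ge0 n k p01; have L1 := law_ge0 (n - d) k p01.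
  have K0 : 0 <= k%:R :> R by [].
  have C0 := chi_ge0 n p01; have C1 := chi_ge0 (n - k) p01.
  have P1 : 0 <= g^-1 * (k%:R * law p n k) by apply: mulr_ge0; [exact: ltW|exact: mulr_ge0].
  have P2 : 0 <= chi p n * ((c1^-1 + C2) * law p (n - d) k).
    apply: mulr_ge0 => //; apply: mulr_ge0 => //; clear -ci0 C20; lra.
  have [top|ntop] := leP (n%:R - k%:R) ((1 - g) / p).
    suff : k%:R * law p n k * chi p (n - k) <= g^-1 * (k%:R * law p n k) by clear -P2; lra.
    rewrite mulrC; apply: ler_wpM2r; first exact: mulr_ge0.
    apply: chi_subcritical_le => //; rewrite natrB //.
    by have := ler_wpM2r (ltW p0) top; rewrite mulfVK // gt_eqF.
  suff : k%:R * law p n k <= (c1^-1 + C2) * law p (n - d) k.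
    move=> h; have : k%:R * law p n k * chi p (n - k) <= chi p n * ((c1^-1 + C2) * law p (n - d) k).
      rewrite [leRHS]mulrC; apply: ler_pM => //; first exact: mulr_ge0.
      by apply: chi_mono => //; exact: leq_subr.
    by clear -P1; lra.
  have [low|nlow] := leP ((1 + 2 * g) / p) (n%:R - k%:R).
    have g01 : 0 < g <= 1 by apply/andP; split => //; clear -g1; lra.
    have dlu : g / (2 * p) <= d%:R <= g / p by rewrite dl du.
    have := law_far_below p01' g01 dlu low dn => h.
    apply: (le_trans (ler_wpM2l K0 h)); rewrite mulrA; apply: ler_wpM2r => //.
    by have := mul_expRN_le c10 K0; rewrite /c1; clear -C20; lra.
  have nk : (1 - g) / p <= n%:R - k%:R <= (1 + 2 * g) / p by rewrite !ltW.
  have g01 : 0 < g <= 4^-1 by rewrite g0.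
  have := law_near_dual p01' g01 e01 ge np du nk dn => h.
  apply: (le_trans (ler_wpM2l K0 h)); rewrite mulrA; apply: ler_wpM2r => //.
  rewrite -expRM_natl.
  have y0 : 0 <= p^-1 by rewrite invr_ge0 ltW.
  have HC := HC2 _ y0.
  suff : k%:R * expR (d%:R * - (e ^+ 2 / 32)) <= p^-1 ^+ 2 * expR (- (c * p^-1)).
    by clear -HC ci0; lra.
  apply: ler_pM => //.
    apply: (@le_trans _ _ n%:R); first by rewrite ler_nat.
    rewrite exprVn -[leRHS]mul1r ler_pdivlMr ?exprn_gt0 //.
    by rewrite mulrC.
  rewrite ler_expR mulrN lerN2.
  have : c * p^-1 = e ^+ 2 / 32 * (g / (2 * p)) by rewrite /c; field; rewrite gt_eqF.
  move=> ->; rewrite [leRHS]mulrC; apply: ler_wpM2l => //; clear -e2; lra.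
have H : \sum_(k < n.+1) k%:R * law p n k * chi p (n - k) <= A * chi p n.
  apply: (@le_trans _ _ (g^-1 * chi p n + chi p n * (c1^-1 + C2))); last first.
    by rewrite /A; clear; lra.
  have S1 : (c1^-1 + C2) = \sum_(k < n.+1) (c1^-1 + C2) * law p (n - d) k.
    rewrite -mulr_sumr; have := @sum_law_widen R p (n - d) n (fun=> 1) nd1.
    under eq_bigr do rewrite mul1r.
    by under [in RHS]eq_bigr do rewrite mul1r; rewrite sum_law // => ->; rewrite mulr1.
  rewrite [in X in _ + X]S1 [X in g^-1 * X]chiE !mulr_sumr -big_split /=.
  by apply: ler_sum => k _; apply: term; rewrite -ltnS ltn_ord.
apply: (le_trans (logder_le p02 n0 H)).
rewrite mulrA; apply: ler_wpM2r => //; clear -gi0; lra.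
Qed.

(** * The lower bound below criticality *)

(** The reverse of [law_tilt] in the subcritical range: adding vertices while
    staying subcritical favours large components. *)
Lemma law_ascent (R : realType) (p b : R) (n d k : nat) : 0 < p -> 0 < b <= 2^-1 ->
  p <= b / 4 -> (n + d)%:R * p <= 1 - b / 2 -> (0 < k <= n)%N ->
  law p n k <= expR (d%:R * (2 * p - k%:R * p * b / 4)) * law p (n + d) k.
Proof.
move=> p0 /andP[b0 b1] pb + /andP[k0 kn].
have p01 : 0 <= p <= 1 by apply/andP; split; [exact: ltW|clear -pb b1; lra].
have K1 : 1 <= k%:R :> R by rewrite ler1n.
elim: d => [|d IHd] ndp; first by rewrite mul0r expR0 mul1r addn0.
have ndp' : (n + d)%:R * p <= (n + d.+1)%:R * p by apply: (ler_wpM2r (ltW p0)); rewrite ler_nat leq_add2l.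
apply: (le_trans (IHd (le_trans ndp' ndp))).
have -> : d.+1%:R * (2 * p - k%:R * p * b / 4)
   = d%:R * (2 * p - k%:R * p * b / 4) + (2 * p - k%:R * p * b / 4).
  by rewrite -[d.+1%:R]natr1; ring.
rewrite expRD -[leRHS]mulrA; apply: ler_wpM2l; first exact: expR_ge0.
rewrite addnS; move: (leq_trans kn (leq_addr d n)) ndp; rewrite addnS.
move: (n + d)%N => m km ndp {IHd ndp'}.
have M0 : 0 < m%:R :> R by rewrite ltr0n (leq_trans k0).
have KM : k%:R <= m%:R :> R by rewrite ler_nat.
rewrite law_ratio //.
have L0 := law_ge0 m k p01.
rewrite mulrA -[leLHS]mul1r; apply: ler_wpM2r => //.
have mk : (m.+1 - k)%:R = m%:R + 1 - k%:R :> R by rewrite natrB ?natr1 // leqW.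
have mk0 : 0 < (m.+1 - k)%:R :> R by rewrite mk; clear -KM; lra.
have f1 : expR ((k%:R - 1) / m%:R) <= m%:R / (m.+1 - k)%:R :> R.
  set x := (_ / m%:R); have mx : m%:R * x = k%:R - 1 by rewrite /x; field; rewrite gt_eqF.
  have h : (m.+1 - k)%:R <= m%:R * expR (- x).
    have := ler_wpM2l (ltW M0) (expR_ge1Dx (- x)); rewrite mk mulrDr mulrN mx; clear; lra.
  rewrite ler_pdivlMr //; apply: (le_trans (ler_wpM2l (expR_ge0 x) h)).
  by rewrite mulrCA expRxMexpNx_1 mulr1.
have f2 : expR (- (k%:R * (p + p ^+ 2))) <= (1 - p) ^+ k.
  rewrite -mulrN expRM_natl; apply: lerXn2r; rewrite ?nnegrE ?expR_ge0 //.
    by clear -pb b1; lra.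
  by apply: expR_one_sub; apply/andP; split; [exact: ltW|clear -pb b1; lra].
apply: (@le_trans _ _ (expR (2 * p - k%:R * p * b / 4) * (expR ((k%:R - 1) / m%:R)
   * expR (- (k%:R * (p + p ^+ 2)))))); last first.
  by apply: ler_wpM2l; [exact: expR_ge0|apply: ler_pM => //; exact: expR_ge0].
rewrite -!expRD -[leLHS]expR0 ler_expR.
have f3 : p * (1 + b / 2) <= m%:R^-1.
  rewrite -[leRHS]mul1r ler_pdivlMr //.
  have mp : m%:R * p <= 1 - b / 2 by move: ndp; rewrite -[m.+1%:R]natr1; clear -p0; lra.
  have b2 : 0 <= 1 + b / 2 by clear -b0; lra.
  have := ler_wpM2r b2 mp; have := sqr_ge0 b; rewrite expr2; clear; lra.
have K10 : 0 <= k%:R - 1 :> R by rewrite subr_ge0.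
have f4 := ler_wpM2l K10 f3.
have K0 : 0 <= k%:R :> R by [].
have kp0 : 0 <= k%:R * p by apply: mulr_ge0 => //; exact: ltW.
have f5 := ler_wpM2l kp0 pb.
have f6 : p * b <= p * 2^-1 by rewrite ler_wpM2l // ltW.
rewrite expr2; clear -f4 f5 f6 p0; lra.
Qed.

(** By [law_ascent], k P_n(k) is at most a constant times
    k exp (- b^2 k / 16) P_(n+d)(k), where n + d vertices are still subcritical with
    margin b / 2; the bound has the order b^(-3) of a subcritical branching
    process. *)
Lemma moment2_subcritical (R : realType) (p b : R) (n : nat) : 0 < p -> 0 < b <= 2^-1 ->
  p <= b / 4 -> n%:R * p <= 1 - b -> (0 < n)%N -> moment2 p n <= 64 / b ^+ 3.
Proof.
move=> p0 b01 pb np n0; have /andP[b0 b1] := b01.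
have p01 : 0 <= p <= 1 by apply/andP; split; [exact: ltW|clear -pb b1; lra].
have bp : 1 <= b / (4 * p) by rewrite ler_pdivlMr; clear -pb p0; lra.
have [d /andP[dl du]] := @ex_nat_between R (b / (4 * p)) (b / (2 * p))
   ltac:(clear -bp; lra)
   ltac:(have : b / (2 * p) = 2 * (b / (4 * p)) by [field; rewrite gt_eqF]; clear -bp; lra).
have dlp : b / 4 <= d%:R * p.
  by have := ler_wpM2r (ltW p0) dl; have -> : b / (4 * p) * p = b / 4 by field; rewrite gt_eqF.
have dup : d%:R * p <= b / 2.
  by have := ler_wpM2r (ltW p0) du; have -> : b / (2 * p) * p = b / 2 by field; rewrite gt_eqF.
have ndp : (n + d)%:R * p <= 1 - b / 2 by rewrite natrD mulrDl; clear -np dup; lra.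
have c0 : 0 < b ^+ 2 / 16 by apply: divr_gt0 => //; exact: exprn_gt0.
have eb : expR b <= 2.
  rewrite -[b]opprK expRN invf_ple ?posrE ?expR_gt0 //.
  by apply: le_trans (expR_ge1Dx _); clear -b1; lra.
have term (k : nat) : (k <= n)%N ->
   k%:R ^+ 2 * law p n k <= 2 * (b ^+ 2 / 16)^-1 * (k%:R * law p (n + d) k).
  move=> kn; have L1 := law_ge0 (n + d) k p01.
  case: (posnP k) => [->|k0]; first by rewrite !law0 !mulr0.
  have K0 : 0 <= k%:R :> R by [].
  have kn' : (0 < k <= n)%N by rewrite k0.
  have H := law_ascent p0 b01 pb ndp kn'.
  apply: (@le_trans _ _ (k%:R ^+ 2 * (2 * expR (- (b ^+ 2 / 16 * k%:R)) * law p (n + d) k))).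
    apply: ler_wpM2l; first exact: exprn_ge0.
    apply: (le_trans H); apply: ler_wpM2r => //.
    apply: (@le_trans _ _ (expR b * expR (- (b ^+ 2 / 16 * k%:R)))); last first.
      by apply: ler_wpM2r => //; exact: expR_ge0.
    rewrite -expRD ler_expR.
    have : d%:R * (2 * p - k%:R * p * b / 4) = 2 * (d%:R * p) - (d%:R * p) * (k%:R * b / 4).
      by field.
    have kb : 0 <= k%:R * b / 4 by rewrite divr_ge0 // mulr_ge0 // ltW.
    have := ler_wpM2r kb dlp; rewrite expr2; clear -dup; lra.
  have := mul_expRN_le c0 K0; set E := expR _; set c := (_ / 16)^-1 => h.
  have -> : k%:R ^+ 2 * (2 * E * law p (n + d) k) = 2 * (k%:R * E) * (k%:R * law p (n + d) k).
    by ring.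
  apply: ler_wpM2r; first exact: mulr_ge0.
  exact: ler_wpM2l.
rewrite /moment2.
apply: (@le_trans _ _ (2 * (b ^+ 2 / 16)^-1 * chi p (n + d))).
  rewrite chiE mulr_sumr.
  apply: (@le_trans _ _ (\sum_(k < n.+1) 2 * (b ^+ 2 / 16)^-1 * (k%:R * law p (n + d) k))).
    by apply: ler_sum => k _; apply: term; rewrite -ltnS ltn_ord.
  have nd : (n.+1 <= (n + d).+1)%N by rewrite ltnS leq_addr.
  rewrite (big_ord_widen _ (fun k => 2 * (b ^+ 2 / 16)^-1 * (k%:R * law p (n + d) k)) nd).
  rewrite big_mkcond /=; apply: ler_sum => k _; case: ifP => // _.
  apply: mulr_ge0; last by rewrite mulr_ge0 ?law_ge0.
  by apply: mulr_ge0 => //; rewrite invr_ge0 ltW.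
have := chi_subcritical_le p01 (divr_gt0 b0 (ltr0n R 2)) ndp => h.
have c1 : 0 <= 2 * (b ^+ 2 / 16)^-1 by apply: mulr_ge0 => //; rewrite invr_ge0 ltW.
apply: (le_trans (ler_wpM2l c1 h)).
by rewrite le_eqVlt; apply/orP; left; apply/eqP; field; rewrite gt_eqF.
Qed.

Lemma bonferroni2 (R : realType) (p : R) (k : nat) : 0 <= p <= 1 ->
  (1 - p) ^+ k <= 1 - k%:R * p + k%:R ^+ 2 * p ^+ 2 / 2.
Proof.
move=> /andP[p0 p1].
suff H : (1 - p) ^+ k <= 1 - k%:R * p + k%:R * (k%:R - 1) * p ^+ 2 / 2.
  apply: (le_trans H); have := mulr_ge0 (ler0n R k) (sqr_ge0 p); clear; lra.
elim: k => [|k IHk]; first by rewrite expr0 !mul0r; lra.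
have q0 : 0 <= 1 - p by rewrite subr_ge0.
rewrite exprS; apply: (le_trans (ler_wpM2l q0 IHk)); rewrite -[k.+1%:R]natr1.
have k2 : 0 <= k%:R * (k%:R - 1) :> R.
  by case: k {IHk} => [|k]; rewrite ?mul0r // mulr_ge0 // subr_ge0 ler1n.
have : 0 <= p ^+ 3 by exact: exprn_ge0.
move=> /(mulr_ge0 k2); rewrite !exprS expr0; clear; lra.
Qed.

(** The lower counterpart of the branching inequality, by the second
    Bonferroni inequality for 1 - q^K. *)
Lemma chi_succ_ge (R : realType) (p : R) (n : nat) : 0 <= p <= 1 -> (0 < n)%N ->
  1 + n%:R * (p * chi p n - p ^+ 2 * moment2 p n / 2) <= chi p n.+1.
Proof.
move=> p01 n0; rewrite chi_succ lerD2l; apply: ler_wpM2l => //.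
rewrite -[X in _ <= X - _](sum_law p n0) chiE mulr_sumr /moment2 mulr_sumr mulr_suml -!sumrB.
apply: ler_sum => k _; have := ler_wpM2r (law_ge0 n k p01) (bonferroni2 k p01); clear; lra.
Qed.

Lemma chi_succ_le (R : realType) (p : R) (n : nat) : 0 <= p <= 1 -> (0 < n)%N ->
  chi p n.+1 <= chi p n + moment2 p n.+1 / n%:R.
Proof.
move=> p01 n0; have nn : (0 < n <= n.+1)%N by rewrite n0 leqnSn.
rewrite -(chi_widen p nn) [in leLHS]chiE /moment2 mulr_suml -big_split /=.
apply: ler_sum => -[k /= lk] _.
case: k lk => [|k] lk; first by rewrite !mul0r !law0 mulr0 mul0r addr0.
have L0 := law_ge0 n k.+1 p01; have L1 := law_ge0 n.+1 k.+1 p01.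
have N0 : 0 < n%:R :> R by rewrite ltr0n.
have K0 : 0 <= k.+1%:R :> R by [].
suff H : law p n.+1 k.+1 <= law p n k.+1 + k.+1%:R * law p n.+1 k.+1 / n%:R.
  have := ler_wpM2l K0 H.
  have -> : k.+1%:R ^+ 2 * law p n.+1 k.+1 / n%:R = k.+1%:R * (k.+1%:R * law p n.+1 k.+1 / n%:R).
    by rewrite expr2 !mulrA.
  by clear; lra.
rewrite -(ler_pM2l N0).
have -> : n%:R * (law p n k.+1 + k.+1%:R * law p n.+1 k.+1 / n%:R) =
  n%:R * law p n k.+1 + k.+1%:R * law p n.+1 k.+1 by field; rewrite gt_eqF.
have [kn|nk] := leqP k.+1 n; last first.
  have kn : n%:R <= k.+1%:R :> R by rewrite ler_nat ltnW.
  by have := ler_wpM2r L1 kn; have := mulr_ge0 (ltW N0) L0; clear; lra.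
have S := law_step p kn.
have E : (n.+1 - k.+1)%:R = n%:R - k.+1%:R + 1 :> R.
  by rewrite natrB ?leqW // -natr1; ring.
have : n%:R * (1 - p) ^+ k.+1 * law p n k.+1 <= n%:R * law p n k.+1.
  apply: ler_wpM2r => //; rewrite -[leRHS]mulr1; apply: ler_wpM2l; first exact: ltW.
  by case/andP: p01 => p0 p1; apply: exprn_ile1; rewrite ?subr_ge0 // gerBl.
by rewrite -S E; move: L1; clear; lra.
Qed.

(** Inserting [chi_succ_le] in [chi_succ_ge] gives
    (1 - n p) chi n >= 1 - O(E K^2 / n), and E K^2 / n = O(1 / (n b^3)). *)
Lemma chi_subcritical_ge (R : realType) (p b : R) (n : nat) : 0 < p -> 0 < b <= 2^-1 ->
  p <= b / 4 -> n.+1%:R * p <= 1 - b -> 192 <= n%:R * b ^+ 3 ->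
  2^-1 <= (1 - n%:R * p) * chi p n.
Proof.
move=> p0 b01 pb np nb; have /andP[b0 b1] := b01.
have p01 : 0 <= p <= 1 by apply/andP; split; [exact: ltW|clear -pb b1; lra].
have b3 : 0 < b ^+ 3 by exact: exprn_gt0.
have n0 : (0 < n)%N by rewrite lt0n; apply/negP => /eqP n0; move: nb; rewrite n0 mul0r; clear; lra.
have N0 : 0 < n%:R :> R by rewrite ltr0n.
have np' : n%:R * p <= 1 - b by move: np; rewrite -[n.+1%:R]natr1; clear -p0; lra.
have M1 := moment2_subcritical p0 b01 pb np' n0.
have M2 := moment2_subcritical p0 b01 pb np (ltn0Sn n).
have H1 := chi_succ_ge p01 n0; have H2 := chi_succ_le p01 n0.
set W := 64 / b ^+ 3 in M1 M2.
have WN : W / n%:R <= 3^-1.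
  rewrite ler_pdivrMr // /W ler_pdivrMr //; clear -nb; lra.
have W0 : 0 <= W by apply: divr_ge0; [exact: ler0n|exact: ltW].
have h2 : moment2 p n.+1 / n%:R <= 3^-1.
  by apply: le_trans WN; apply: ler_wpM2r => //; rewrite invr_ge0 ltW.
have h1 : n%:R * (p ^+ 2 * moment2 p n) <= 3^-1.
  apply: le_trans WN.
  have np0 : 0 <= n%:R * p by apply: mulr_ge0; exact: ltW.
  have -> : n%:R * (p ^+ 2 * moment2 p n) = (n%:R * p) ^+ 2 * (moment2 p n / n%:R).
    by field; rewrite gt_eqF.
  have m0 : 0 <= moment2 p n / n%:R.
    apply: divr_ge0; last exact: ltW.
    by apply: sumr_ge0 => k _; rewrite mulr_ge0 ?exprn_ge0 ?law_ge0.
  apply: (@le_trans _ _ (1 * (moment2 p n / n%:R))).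
    apply: ler_wpM2r => //; apply: exprn_ile1 => //; clear -np' b0; lra.
  by rewrite mul1r; apply: ler_wpM2r => //; rewrite invr_ge0 ltW.
clear -H1 H2 h1 h2; lra.
Qed.

(** With m about b n, sizes above m carry at most half of [chi n], and removing
    m vertices still leaves a susceptibility of order 1 / b. *)
Lemma logder_subcritical_ge (R : realType) (p b : R) (n : nat) : 0 < b <= 4^-1 ->
  n%:R * p = 1 - b -> 4096 <= n%:R * b ^+ 3 -> n%:R / (16 * b) <= logder p n.
Proof.
move=> /andP[b0 b1] np nb.
have b3 : 0 < b ^+ 3 by exact: exprn_gt0.
have n0 : (0 < n)%N by rewrite lt0n; apply/negP => /eqP n0; move: nb; rewrite n0 mul0r; clear; lra.
have N0 : 0 < n%:R :> R by rewrite ltr0n.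
have bb : b * b <= 4^-1 * b by apply: ler_wpM2r => //; exact: ltW.
have nbb : 4096 <= n%:R * b * (b * b) by rewrite -!mulrA; move: nb; rewrite !exprS expr0 mulr1.
have NB0 : 0 < n%:R * b by exact: mulr_gt0.
have nb1 : 64 <= n%:R * b.
  have h : b * b <= 16^-1 by clear -bb b1; lra.
  by have := ler_wpM2l (ltW NB0) h; clear -nbb; lra.
have p0 : 0 < p.
  by rewrite -(pmulr_rgt0 _ N0) np; clear -b1; lra.
have pb : p <= b / 8.
  rewrite -(ler_pM2l N0) np mulrA ler_pdivlMr //; clear -nb1 b0; lra.
have p01 : 0 <= p <= 1 by apply/andP; split; [exact: ltW|clear -pb b1; lra].
have c0 : 0 < chi p n by apply: lt_le_trans (chi_ge1 p01 n0).
have [m /andP[ml mu]] := @ex_nat_between R (n%:R * b / 2) (n%:R * b)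
  ltac:(clear -nb1; lra) ltac:(clear -nb1; lra).
have mn2 : m%:R * 4 <= n%:R :> R.
  by have := ler_wpM2l (ltW N0) b1; clear -mu; lra.
have mn : (m < n)%N by rewrite -(ltr_nat R); clear -mn2 N0; lra.
have M0 : 0 < m%:R :> R by clear -ml nb1; lra.
have nm : (n - m)%:R = n%:R - m%:R :> R by rewrite natrB // ltnW.
have pm : m%:R * p <= b.
  have := ler_wpM2r (ltW p0) mu; have : n%:R * b * p = b * (1 - b) by rewrite -np; ring.
  have := sqr_ge0 b; rewrite expr2; clear; lra.
have pm0 : 0 <= m%:R * p by apply: mulr_ge0; exact: ltW.
have b02 : 0 < b / 2 <= 2^-1 by apply/andP; split; clear -b0 b1; lra.
have b0h : 0 < b <= 2^-1 by apply/andP; split => //; clear -b1; lra.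
have pb2 : p <= b / 2 / 4 by clear -pb; lra.
have b8 : (b / 2) ^+ 3 = b ^+ 3 / 8 by field.
have chi1 : 2^-1 <= (1 - n%:R * p) * chi p n.
  apply: (chi_subcritical_ge p0 b02 pb2); first by rewrite -[n.+1%:R]natr1 mulrDl np mul1r; clear -pb b0; lra.
  by rewrite b8; clear -nb; lra.
have chi2 : 2^-1 <= (1 - (n - m)%:R * p) * chi p (n - m).
  apply: (chi_subcritical_ge p0 b02 pb2).
    by rewrite -[(n - m).+1%:R]natr1 nm mulrDl mulrBl np mul1r; clear -pb b0 pm0; lra.
  rewrite b8 nm; have := ler_wpM2r (ltW b3) mn2; clear -nb; lra.
have chi1' : (2 * b)^-1 <= chi p n.
  rewrite -[leLHS]mul1r ler_pdivrMr; last by clear -b0; lra.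
  by move: chi1; rewrite np; clear; lra.
have C2 := chi_ge0 (n - m) p01.
have chi2' : (4 * b)^-1 <= chi p (n - m).
  rewrite -[leLHS]mul1r ler_pdivrMr; last by clear -b0; lra.
  have E : 1 - (n - m)%:R * p = b + m%:R * p by rewrite nm mulrBl np; ring.
  move: chi2; rewrite E => h.
  have := ler_wpM2r C2 pm; clear -h; lra.
have pb4 : p <= b / 4 by clear -pb b0; lra.
have np' : n%:R * p <= 1 - b by rewrite np.
have M2 := moment2_subcritical p0 b0h pb4 np' n0.
have tail : moment2 p n / m%:R <= chi p n / 2.
  rewrite ler_pdivrMr //; apply: (le_trans M2).
  rewrite ler_pdivrMr //.
  have h1 : (2 * b)^-1 * (n%:R * b / 2) <= chi p n * m%:R.
    apply: ler_pM => //; first by rewrite invr_ge0; clear -b0; lra.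
    by clear -NB0; lra.
  have h2 := ler_wpM2r (ltW b3) h1.
  have : (2 * b)^-1 * (n%:R * b / 2) * b ^+ 3 = n%:R * b ^+ 3 / 4 by field; rewrite gt_eqF.
  by clear -h2 nb; lra.
have q0 : 0 < 1 - p by clear -pb b1; lra.
have NM0 : 0 <= (n - m)%:R * chi p (n - m) by exact: mulr_ge0.
have S : (n - m)%:R * chi p (n - m) * (chi p n - moment2 p n / m%:R)
     <= (1 - p) * (chi_poly R n)^`().[p].
  rewrite russo [chi p n]chiE /moment2 mulr_suml -sumrB mulr_sumr.
  apply: ler_sum => -[k /= lk] _; have L0 := law_ge0 n k p01.
  have [km|mk] := leqP k m.
    have kn : (k <= n)%N by apply: (leq_trans km); exact: ltnW.
    apply: (@le_trans _ _ ((n - m)%:R * chi p (n - m) * (k%:R * law p n k))).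
      apply: ler_wpM2l => //; rewrite lerBlDr lerDl divr_ge0 // mulr_ge0 // exprn_ge0 //.
    rewrite natrM.
    have -> : k%:R * (n - k)%:R * law p n k * chi p (n - k) =
      (n - k)%:R * chi p (n - k) * (k%:R * law p n k) by ring.
    apply: ler_wpM2r; first exact: mulr_ge0.
    apply: ler_pM => //; first by rewrite ler_nat leq_sub2l.
    by apply: chi_mono => //; exact: leq_sub2l.
  apply: (@le_trans _ _ 0); last by rewrite !mulr_ge0 ?chi_ge0.
  apply: mulr_ge0_le0 => //; rewrite subr_le0 ler_pdivlMr // mulrAC.
  rewrite expr2; apply: ler_wpM2r => //; apply: ler_wpM2l => //.
  by rewrite ler_nat ltnW.
have X0 : 0 <= (1 - p) * (chi_poly R n)^`().[p].
  by rewrite russo; apply: sumr_ge0 => k _; rewrite !mulr_ge0 ?law_ge0 ?chi_ge0.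
have X1 : (1 - p) * (chi_poly R n)^`().[p] <= (chi_poly R n)^`().[p].
  by move: X0; rewrite pmulr_rge0 // => x0; rewrite ler_piMl //; clear -p0; lra.
rewrite /logder ler_pdivlMr //; apply: le_trans X1; apply: le_trans S.
have h3 : (n%:R / 2) * (4 * b)^-1 <= (n - m)%:R * chi p (n - m).
  apply: ler_pM => //.
  - by rewrite invr_ge0 mulr_ge0 // ltW.
  - by rewrite nm; clear -mn2 N0; lra.
have h4 : chi p n / 2 <= chi p n - moment2 p n / m%:R by clear -tail; lra.
have i0 : 0 <= (n%:R / 2) * (4 * b)^-1.
  by apply: mulr_ge0; [clear -N0; lra|rewrite invr_ge0 mulr_ge0 // ltW].
have z0 : 0 <= chi p n / 2 by clear -c0; lra.
apply: le_trans (ler_pM i0 z0 h3 h4).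
by rewrite le_eqVlt; apply/orP; left; apply/eqP; field; rewrite gt_eqF.
Qed.

(** * Location and size of the maximum *)

Lemma logder_window_le (R : realType) (L s p : R) (n : nat) : 1 <= L -> 512 * L <= s ->
  n%:R = s ^+ 3 -> 0 <= p -> n%:R * p <= 1 + L / s ->
  logder p n <= 48 / L * expR (13 * L ^+ 3) * (n%:R * s).
Proof.
move=> L1 sL ns p0 np.
have L0 : 0 < L by clear -L1; lra.
have s0 : 0 < s by clear -L1 sL; lra.
have N0 : 0 < n%:R :> R by rewrite ns; exact: exprn_gt0.
have n0 : (0 < n)%N by rewrite -(ltr0n R).
have b01 : 0 < L / s <= 512^-1.
  apply/andP; split; first exact: divr_gt0.
  by rewrite ler_pdivrMr //; clear -sL; lra.
have [b0 b1] := andP b01.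
have bn : (L / s) ^+ 3 * n%:R = L ^+ 3 by rewrite ns; field; rewrite gt_eqF.
have bn1 : 1 <= (L / s) ^+ 3 * n%:R by rewrite bn exprn_ege1.
have n4 : 4 <= n%:R :> R.
  have s4 : 4 <= s by clear -L1 sL; lra.
  rewrite ns; apply: (le_trans s4); rewrite -[leLHS]expr1 ler_weXn2l //; clear -s4; lra.
have p02 : 0 <= p <= 2^-1.
  rewrite p0 /= -(ler_pM2l N0); clear -np b1 n4; lra.
apply: (le_trans (logder_le_chi p02 n0)).
have H := chi_window_le p02 b01 bn1 np; rewrite bn in H.
have -> : 48 / L * expR (13 * L ^+ 3) * (n%:R * s) = 2 * (24 / (L / s) * expR (13 * L ^+ 3) * n%:R).
  by field; rewrite !gt_eqF.
by rewrite ler_pM2l //; apply: ler_wpM2r.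
Qed.

(** With the threshold 128000 the bounds 2 n s / L and 500 n s / L
    of the sub- and supercritical regimes fall below the value n s / 256 that is
    reached inside the window; here s is n^(1/3). *)
Lemma logder_off_window (R : realType) (L : R) : 128 * 1000 < L ->
  exists2 S : R, 0 < S & forall (n : nat) (s p : R), S <= s -> n%:R = s ^+ 3 ->
    0 < p < 1 -> L / s < `|n%:R * p - 1| -> logder p n < n%:R * s / 256.
Proof.
move=> L1; have L0 : 0 < L by clear -L1; lra.
have M0 : 0 < 128 * 1000 :> R by clear; lra.
have LI : L^-1 <= (128 * 1000)^-1.
  by move: (128 * 1000 : R) M0 L1 => M M0 /ltW LM; rewrite lef_pV2.
have e01 : 0 < (150^-1 : R) <= 2^-1 by apply/andP; split; clear; lra.
have [CD CD0 HD] := @logder_macroscopic R 150^-1 e01.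
have [CE CE0 HE] := logder_dense R.
exists (L + 257 * CD + 257 * CE + 4); first by clear -L0 CD0 CE0; lra.
move=> n s p Ss ns /andP[p0 p1] off.
have s4 : 4 <= s by clear -L0 CD0 CE0 Ss; lra.
have s0 : 0 < s by clear -s4; lra.
have s1 : 1 <= s by clear -s4; lra.
have sn : s <= n%:R.
  by rewrite ns -[leLHS]expr1 ler_weXn2l.
have s2n : s ^+ 2 <= n%:R by rewrite ns ler_weXn2l.
have N0 : 0 < n%:R :> R by clear -sn s0; lra.
have n0 : (0 < n)%N by rewrite -(ltr0n R).
have n4 : 4 <= n%:R :> R by clear -sn s4; lra.
have sCD : 256 * CD < s by clear -L0 CD0 CE0 Ss; lra.
have sCE : 256 * CE < s by clear -L0 CD0 CE0 Ss; lra.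
have NS0 : 0 < n%:R * s by exact: mulr_gt0.
have p01 : 0 <= p <= 1 by rewrite !ltW.
have [np1|np1] := leP (n%:R * p) 1.
  have h : n%:R * p <= 1 - L / s.
    by move: off; rewrite ler0_norm; clear -np1; lra.
  have p02 : 0 <= p <= 2^-1 by rewrite ltW //= -(ler_pM2l N0); clear -np1 n4; lra.
  apply: (le_lt_trans (logder_le_chi p02 n0)).
  have := chi_subcritical_le p01 (divr_gt0 L0 s0) h; rewrite invf_div => hc.
  have hL : s / L <= s / (128 * 1000) by exact: (ler_wpM2l (ltW s0)).
  have := ler_wpM2r (ltW N0) (le_trans hc hL).
  by clear -NS0; lra.
have [small|big] := leP (n%:R * p - 1) 150^-1.
  have e0 : 0 < n%:R * p - 1 by clear -np1; lra.
  have off' : L / s < n%:R * p - 1 by move: off; rewrite gtr0_norm.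
  have p02 : 0 <= p <= 2^-1 by rewrite ltW //= -(ler_pM2l N0); clear -small n4; lra.
  have e01' : 0 < n%:R * p - 1 <= 150^-1 by rewrite e0.
  have npe : n%:R * p = 1 + (n%:R * p - 1) by rewrite addrC subrK.
  have h16 : 16 / s <= n%:R * p - 1.
    apply: le_trans (ltW off'); rewrite ler_wpM2r ?invr_ge0 ?(ltW s0) //; clear -L1; lra.
  have en : 1 <= ((n%:R * p - 1) / 16) ^+ 3 * n%:R.
    have i0 : 0 <= s^-1 by rewrite invr_ge0 ltW.
    have : (s^-1) ^+ 3 <= ((n%:R * p - 1) / 16) ^+ 3.
      apply: lerXn2r; rewrite ?nnegrE //; first by clear -e0; lra.
      by clear -h16; lra.
    move/(ler_wpM2r (ltW N0)); apply: le_trans; rewrite ns exprVn mulVf //.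
    by rewrite gt_eqF // exprn_gt0.
  apply: (le_lt_trans (logder_supercritical p02 e01' npe en)).
  have : n%:R / (n%:R * p - 1) < n%:R * (s / L).
    rewrite ltr_pM2l // -[ltRHS]invf_div ltf_pV2 ?posrE //; exact: divr_gt0.
  have hL : s / L <= s / (128 * 1000) by exact: (ler_wpM2l (ltW s0)).
  have := ler_wpM2l (ltW N0) hL.
  by clear -NS0; lra.
have [sparse|dense] := leP (p ^+ 2 * n%:R) 1.
  have hp : 1 + 150^-1 <= n%:R * p by clear -big; lra.
  have Cp : CD * p <= 1.
    rewrite -(@ler_pXn2r _ 2) ?nnegrE //; last by apply: mulr_ge0; exact: ltW.
    rewrite expr1n exprMn; apply: (@le_trans _ _ (n%:R * p ^+ 2)).
      apply: ler_wpM2r; first exact: sqr_ge0.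
      apply: le_trans s2n; apply: lerXn2r; rewrite ?nnegrE ?(ltW CD0) ?(ltW s0) //.
      by clear -sCD CD0; lra.
    by rewrite mulrC.
  apply: (le_lt_trans (HD n p Cp p0 hp sparse)).
  have : CD * n%:R < s / 256 * n%:R by rewrite ltr_pM2r //; clear -sCD; lra.
  by clear; lra.
have p01' : 0 < p < 1 by rewrite p0.
have n4' : (4 <= n)%N by rewrite -(ler_nat R).
have CEn : CE <= n%:R by clear -sCE sn CE0; lra.
apply: (le_lt_trans (HE n p p01' CEn n4' (ltW dense))).
have : 1 * s <= n%:R * s by rewrite ler_pM2r //; clear -n4; lra.
by clear -sCE; lra.
Qed.

Lemma logder_continuous (R : realType) (n : nat) (a b : R) : (0 < n)%N -> 0 <= a -> b <= 1 ->
  {within `[a, b], continuous (fun p => logder p n)}.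
Proof.
move=> n0 a0 b1; apply: continuous_in_subspaceT => p.
rewrite mem_setE in_itv /= => /andP[ap pb].
have p01 : 0 <= p <= 1 by rewrite (le_trans a0) //= (le_trans pb).
apply: cvgM; first exact: continuous_horner.
apply: cvgV; last exact: continuous_horner.
by rewrite gt_eqF // (lt_le_trans ltr01) // chi_ge1.
Qed.

Theorem theorem1p1 (R : realType) :
  exists (c C : R) (n0 : nat),
    [/\ 0 < c, c <= C &
      forall (n : nat) (v : 'I_n), (n0 <= n)%N ->
        (exists p : R, is_argmax `]0, 1[ (dlog_susceptibility v) p) /\
        (forall p : R, is_argmax `]0, 1[ (dlog_susceptibility v) p ->
           `|p - n%:R^-1| <= C * n%:R `^ (- (4 / 3)) /\
           c * n%:R `^ (4 / 3) <= dlog_susceptibility v p <= C * n%:R `^ (4 / 3))].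
Proof.
have [L L1] : exists L : R, 128 * 1000 < L by exists (128 * 1000 + 1); clear; lra.
have L0 : 1 <= L by clear -L1; lra.
have [S S0 off] := logder_off_window L1.
pose C1 := 48 / L * expR (13 * L ^+ 3).
have C10 : 0 <= C1.
  apply: mulr_ge0; last exact: expR_ge0.
  by apply: divr_ge0; [exact: ler0n|clear -L0; lra].
pose T := S + 512 * L.
have T0 : 0 < T by rewrite /T; clear -S0 L0; lra.
exists 256^-1, (L + C1), (Num.truncn (T ^+ 3)).+1; split.
- by rewrite invr_gt0.
- by clear -L0 C10; lra.
move=> n v nn; have n0 : (0 < n)%N by apply: leq_trans nn.
have N0 : 0 < n%:R :> R by rewrite ltr0n.
pose s : R := n%:R `^ 3^-1.
have s0 : 0 < s by exact: powR_gt0.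
have ns : n%:R = s ^+ 3.
  by rewrite -powR_mulrn ?(ltW s0) // -powRrM mulVf // powRr1 // ltW.
have n43 : n%:R `^ (4 / 3) = n%:R * s :> R.
  have -> : 4 / 3 = 1 + 3^-1 :> R by field.
  by rewrite powRD; [rewrite powRr1 // ltW|rewrite (gt_eqF N0) implybT].
have nN43 : n%:R `^ (- (4 / 3)) = (n%:R * s)^-1 :> R by rewrite powRN n43.
have Ts : T <= s.
  rewrite -(@ler_pXn2r _ 3) ?nnegrE ?(ltW T0) ?(ltW s0) // -ns.
  have /andP[_ /ltW h] := Num.Theory.truncn_itv (exprn_ge0 3 (ltW T0)).
  by apply: (le_trans h); rewrite ler_nat.
have sL : 512 * L <= s by move: Ts; rewrite /T; clear -S0; lra.
have Ss : S <= s by move: Ts; rewrite /T; clear -L0; lra.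
have Ls : L / s <= 512^-1 by rewrite ler_pdivrMr //; clear -sL; lra.
have Ls0 : 0 < L / s by apply: divr_gt0 => //; clear -L0; lra.
have NS0 : 0 < n%:R * s by exact: mulr_gt0.
have n2 : 2 <= n%:R :> R.
  have s2 : 2 <= s by clear -sL L0; lra.
  rewrite ns; apply: (le_trans s2); rewrite -[leLHS]expr1 ler_weXn2l //; clear -s2; lra.
have i0 : 0 < n%:R^-1 :> R by rewrite invr_gt0.
pose a := n%:R^-1 * (1 - L / s); pose b := n%:R^-1 * (1 + L / s).
have a0 : 0 < a by apply: mulr_gt0 => //; clear -Ls; lra.
have b1 : b < 1.
  by rewrite /b mulrC ltr_pdivrMr //; clear -Ls n2; lra.
have ab : a <= b by rewrite ler_pM2l //; clear -Ls0; lra.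
pose p0 := n%:R^-1 * (1 - 16 / s).
have np0 : n%:R * p0 = 1 - 16 / s by rewrite /p0 mulrA divff ?gt_eqF // mul1r.
have is0 : 0 < s^-1 by rewrite invr_gt0.
have L16 : 16 / s <= L / s by rewrite ler_pM2r //; clear -L1; lra.
have p0ab : p0 \in `[a, b].
  rewrite in_itv /= !ler_pM2l //; apply/andP; split; clear -L16 Ls0 is0; lra.
have p0low : n%:R * s / 256 <= logder p0 n.
  have b16 : 0 < 16 / s <= 4^-1 by apply/andP; split; [clear -is0; lra|clear -L16 Ls; lra].
  have := logder_subcritical_ge b16 np0.
  have -> : n%:R / (16 * (16 / s)) = n%:R * s / 256 by field; rewrite gt_eqF.
  apply; rewrite ns le_eqVlt; apply/orP; left; apply/eqP; field; rewrite gt_eqF //.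
(* The maximum over [a, b] is global, because the value at p0 exceeds all values
   outside [a, b]. *)
have [pm pmab pmax] := EVT_max ab (logder_continuous n0 (ltW a0) (ltW b1)).
have dE p : 0 < p < 1 -> dlog_susceptibility v p = logder p n.
  by move=> /andP[h1 h2]; apply: dlog_susceptibilityE; rewrite !ltW.
have in01 p : p \in `[a, b] -> 0 < p < 1.
  by rewrite in_itv /= => /andP[h1 h2]; rewrite (lt_le_trans a0) //= (le_lt_trans h2).
have inab p : `|n%:R * p - 1| <= L / s -> p \in `[a, b].
  rewrite ler_norml => /andP[h1 h2]; rewrite in_itv /= /a /b.
  rewrite ler_pdivrMl // ler_pdivlMl //; apply/andP; split; clear -h1 h2; lra.
split.
  exists pm; split; first by rewrite /= in_itv /=; exact: in01.
  move=> y; rewrite /= in_itv /= => y01; rewrite !dE //; last exact: in01.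
  have [close|far] := leP `|n%:R * y - 1| (L / s); first exact: pmax (inab _ close).
  apply: le_trans (pmax _ p0ab); apply: le_trans p0low.
  exact: ltW (off n s y Ss ns y01 far).
move=> p [+ pargmax]; rewrite /= in_itv /= => p01.
have low : n%:R * s / 256 <= logder p n.
  apply: (le_trans p0low); rewrite -!dE //; last exact: in01.
  by apply: pargmax; rewrite /= in_itv /=; exact: in01.
have close : `|n%:R * p - 1| <= L / s.
  rewrite leNgt; apply/negP => far.
  by have := off n s p Ss ns p01 far; rewrite ltNge low.
have [p0' p1'] := andP p01.
have up : logder p n <= C1 * (n%:R * s).
  apply: logder_window_le => //; first exact: ltW.
  by move: close; rewrite ler_norml => /andP[_]; clear; lra.
rewrite n43 nN43 dE //; split.
  have -> : p - n%:R^-1 = n%:R^-1 * (n%:R * p - 1) by field; rewrite gt_eqF.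
  rewrite normrM gtr0_norm // invfM.
  have := ler_wpM2l (ltW i0) close; have := mulr_ge0 C10 (mulr_ge0 (ltW i0) (ltW is0)).
  by clear; lra.
apply/andP; split; first by move: low; clear; lra.
have := mulr_ge0 (le_trans ler01 L0) (ltW NS0); move: up; clear; lra.
Qed.
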